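(* Let $T>0$, $I=[0,T]$, $\nu_1,\nu_2\in\mathbb{R}$ and $p>1$. Assume: (H1) $\Phi:\mathbb{R}\to\mathbb{R}$ is a strictly increasing homeomorphism; (H2) $A:W^{1,p}(I)\to C(I,\mathbb{R})$, $x\mapsto A_x$, is continuous with respect to the uniform topology of $C(I,\mathbb{R})$ on $W^{1,p}(I)\subseteq C(I,\mathbb{R})$, and there exist $h_1,h_2\in C(I,\mathbb{R})$ with $h_1,h_2\ge0$ on $I$, $1/h_1,1/h_2\in L^p(I)$, and $h_1(t)\le A_x(t)\le h_2(t)$ for every $x\in W^{1,p}(I)$ and every $t\in I$; (H3) $F:W^{1,p}(I)\to L^1(I)$, $x\mapsto F_x$, is continuous (usual norms) and there is a non-negative $\psi\in L^1(I)$ with $|F_x(t)|\le\psi(t)$ for every $x\in W^{1,p}(I)$ and a.e. $t\in I$. Then the boundary value problem $(\Phi(A_x(t)x'(t)))'=F_x(t)$ a.e. on $I$, $x(0)=\nu_1$, $x(T)=\nu_2$ admits at least one solution $x\in W^{1,p}(I)$.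
   Context: A continuous $x\in C(I,\mathbb{R})$ is a solution of this problem if $x\in W^{1,p}(I)$, $t\mapsto\Phi(A_x(t)x'(t))$ belongs to $W^{1,1}(I)$ (coincides a.e. with an absolutely continuous function), $(\Phi(A_x(t)x'(t)))'=F_x(t)$ for a.e. $t\in I$, and $x(0)=\nu_1$, $x(T)=\nu_2$. *)

(* Defs.v *)
From HB Require Import structures.
From mathcomp Require Import all_boot all_order all_algebra.
From mathcomp Require Import all_classical all_reals all_analysis.
Set Implicit Arguments. Unset Strict Implicit. Unset Printing Implicit Defensive.
Import Order.TTheory GRing.Theory Num.Theory.
Import numFieldNormedType.Exports.
Local Open Scope classical_set_scope.
Local Open Scope ring_scope.

Section Defs.
Variable R : realType.
Local Notation mu := (@lebesgue_measure R).

Definition Icc (T : R) : set R := `[0, T].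

Definition inLp (T p : R) (g : R -> R) : Prop :=
  measurable_fun (Icc T) g /\
  (\int[mu]_(t in Icc T) ((`|g t| `^ p)%:E) < +oo)%E.

Definition Lpnorm (T p : R) (g : R -> R) : R :=
  (fine (\int[mu]_(t in Icc T) ((`|g t| `^ p)%:E))) `^ p^-1.

Definition L1dist (T : R) (f g : R -> R) : R :=
  fine (\int[mu]_(t in Icc T) (`|f t - g t|%:E)).

(* g is (a representative of) the weak derivative of x on [0,T]:
   g ∈ L^p and x(t) = x(0) + ∫_0^t g for all t ∈ [0,T]. *)
Definition W1p_deriv (T p : R) (x g : R -> R) : Prop :=
  inLp T p g /\
  forall t, 0 <= t <= T -> x t = x 0 + Rintegral mu (Icc t) g.

(* x ∈ W^{1,p}(0,T) (continuous representative). *)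
Definition W1p (T p : R) (x : R -> R) : Prop := exists g, W1p_deriv T p x g.

Definition sup_lt (T : R) (f g : R -> R) (d : R) : Prop :=
  exists2 M, M < d & forall t, 0 <= t <= T -> `|f t - g t| <= M.

Definition inv_inLp (T p : R) (h : R -> R) : Prop :=
  mu (Icc T `&` [set t | h t = 0]) = 0%E /\ inLp T p (fun t => (h t)^-1).

Definition abs_cont_on (T : R) (u : R -> R) : Prop :=
  forall eps : R, 0 < eps -> exists2 delta : R, 0 < delta &
    forall (n : nat) (a b : nat -> R),
      (forall k, (k < n)%N -> 0 <= a k <= b k /\ b k <= T) ->
      (forall i j, (i < n)%N -> (j < n)%N -> i <> j -> b i <= a j \/ b j <= a i) ->
      \sum_(k < n) (b k - a k) < delta ->
      \sum_(k < n) `|u (b k) - u (a k)| < eps.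

End Defs.

(* Main.v *)
(* With w = Phi(A_x x'), the problem reads x' = Phi^-1(w) / A_x, w' = F_x, where the
   initial value w(0) is to be adjusted so that x(T) = nu2.  Consider the operator
   sending (x, w) to (y, z), where
     y(t) = nu1 + int_0^t Phi^-1(w) / A_x,
     z(t) = clip (w(0) + nu2 - y(T)) + int_0^t F_y,
   and clip truncates to a large interval.  It maps into itself a compact convex set of
   pairs (x, w) whose increments are dominated by those of the primitives of
   const / h1 and psi.  At a fixed point the truncation is inactive: otherwise w would be so
   large, with a constant sign, that x would overshoot nu2.  Hence x(T) = nu2.

   Since A is only continuous on W^{1,p}, one needs that every x of the compact set lies in
   W^{1,p}: this is the Radon-Nikodym theorem for the Stieltjes measures of K + x and
   K - x, K being the dominating primitive.

   Schauder's theorem on such a set is reduced to finite nets and to Kuhn's cubical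
   form of Sperner's lemma, which is Stokes' formula for the cup product
   d e_1 \cup ... \cup d e_n of the coboundaries of 0/1 labels over F_2. *)
Require Import Defs.
From HB Require Import structures.
From mathcomp Require Import all_boot all_order all_algebra.
From mathcomp Require Import all_classical all_reals all_analysis.
From mathcomp Require Import measurable_realfun.
From mathcomp Require Import ring lra zify.
Import Order.TTheory GRing.Theory Num.Theory.
Import numFieldNormedType.Exports.
Local Open Scope classical_set_scope.
Local Open Scope ring_scope.

(** * Kuhn's cubical lemma *)

Section Kuhn.
Implicit Types (v w : nat -> nat) (i j k : nat) (s l : seq nat).

Let F2 := 'F_2.

Let addF2 (x : F2) : x + x = 0.
Proof. by rewrite -mulr2n -mulr_natr pchar_Fp_0 ?mulr0. Qed.

Definition set_coord j a v : nat -> nat := fun i => if i == j then a else v i.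

Definition bump_coord j v : nat -> nat := set_coord j (v j).+1 v.

Lemma set_coordC i j a b v : i != j ->
  set_coord i a (set_coord j b v) = set_coord j b (set_coord i a v).
Proof.
move=> ij; apply/funext => k; rewrite /set_coord.
by case: (eqVneq k i) => [->|//]; rewrite (negbTE ij).
Qed.

Lemma set_coordK j a b v : set_coord j a (set_coord j b v) = set_coord j a v.
Proof. by apply/funext => k; rewrite /set_coord; case: eqP. Qed.

Lemma bump_coordC i j v :
  bump_coord i (bump_coord j v) = bump_coord j (bump_coord i v).
Proof.
have [->//|ij] := eqVneq i j; apply/funext => k.
have ji : j == i = false by rewrite eq_sym (negbTE ij).
rewrite /bump_coord /set_coord (negbTE ij) ji.
by case: (eqVneq k i) => // ->; rewrite (negbTE ij).
Qed.

Local Notation del j s := (seq.filter (predC1 j) s).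

(* The cup product [df_1 \cup ... \cup df_k] of coboundaries with coefficients
   in F_2, evaluated on the cube with lower corner [v] and directions [s]
   (Serre's formula: a sum over the monotone edge paths of the cube). *)
Fixpoint cup (fs : seq ((nat -> nat) -> F2)) s v : F2 :=
  if fs is f :: fs' then
    \sum_(j <- s) (f (bump_coord j v) + f v) * cup fs' (del j s) (bump_coord j v)
  else 1.

(** The ordered pairs [(i, j)] and [(j, i)] contribute equally and cancel in characteristic 2. *)
Let sum_sym_pairs (h : nat -> nat -> F2) s : (forall i j, h i j = h j i) ->
  \sum_(j <- s) \sum_(i <- s | i != j) h i j = 0.
Proof.
move=> hC; elim: s => [|a s IH]; first by rewrite big_nil.
rewrite big_cons big_cons eqxx /=.
rewrite [X in _ + X](eq_bigr (fun j => (if a != j then h a j else 0) +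
    \sum_(i <- s | i != j) h i j)); last first.
  by move=> j _; rewrite big_cons; case: (a != j); rewrite ?add0r.
rewrite big_split /= IH addr0 -big_mkcond /=.
rewrite (eq_bigr _ (fun i _ => hC i a)) (eq_bigl (fun i => a != i)) ?addF2//.
by move=> i; rewrite eq_sym.
Qed.

(** The mod 2 cubical coboundary: the summand for [j] pairs the two opposite facets orthogonal to
    direction [j]. *)
Let coboundary (h : seq nat -> (nat -> nat) -> F2) s v : F2 :=
  \sum_(j <- s) (h (del j s) (bump_coord j v) + h (del j s) v).

(** A face of codimension 2 is reached through two facets, according to the order in which its two
    directions are removed. *)
Let coboundary2 h s v : coboundary (coboundary h) s v = 0.
Proof.
rewrite /coboundary; under eq_bigr do rewrite -big_split big_filter.
apply: sum_sym_pairs => i j /=.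
rewrite bump_coordC (_ : del i (del j s) = del j (del i s)); first by ring.
by rewrite -!filter_predI; apply: eq_filter => k /=; rewrite andbC.
Qed.

(** Leibniz rule: the coboundary of the product of [f] with a cochain [c] is [df \cup c] plus [f]
    times the coboundary of [c], and the last term vanishes for closed [c]. *)
Let cup_coboundary_closed fs s v : coboundary (cup fs) s v = 0 ->
  forall f, cup (f :: fs) s v = coboundary (fun s v => f v * cup fs s v) s v.
Proof.
rewrite /coboundary => H f /=; apply/eqP; rewrite -subr_eq0; apply/eqP.
transitivity (f v * \sum_(j <- s) (cup fs (del j s) (bump_coord j v) + cup fs (del j s) v)).
  rewrite -sumrB mulr_sumr; apply: eq_bigr => j _.
  set a := f v; set b := f _; set c := cup _ _ _; set d := cup _ _ _.
  (* Signs are invisible mod 2, but not to [ring]: adding the zero [a * d + a * d] turns [- a * d]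
     into [a * d]. *)
  rewrite -[LHS]addr0 -(addF2 (a * d)); ring.
by rewrite H mulr0.
Qed.

(** By induction, the product with one more factor is itself a coboundary, hence closed. *)
Let coboundary_cup fs s v : coboundary (cup fs) s v = 0.
Proof.
elim: fs s v => [|f fs IH] s v.
  by rewrite /coboundary big1 // => j _; rewrite addF2.
rewrite -[RHS](coboundary2 (fun s v => f v * cup fs s v) s v).
by apply: eq_bigr => j _; congr (_ + _); exact: cup_coboundary_closed.
Qed.

Let cup_cons f fs s v :
  cup (f :: fs) s v = coboundary (fun s v => f v * cup fs s v) s v.
Proof. exact/cup_coboundary_closed/coboundary_cup. Qed.

Variable N : nat.

(** Integration of a cochain over the box [[0, N]^s] cut into unit cubes, each represented by its
    lower corner; [v] fixes the remaining coordinates. *)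
Fixpoint box_sum s (g : (nat -> nat) -> F2) v : F2 :=
  if s is j :: s' then \sum_(a < N) box_sum s' g (set_coord j a v) else g v.

Let eq_box_sum s g h v : g =1 h -> box_sum s g v = box_sum s h v.
Proof. by move/funext->. Qed.

Let box_sum_sum (I : Type) (r : seq I) (g : I -> (nat -> nat) -> F2) s v :
  box_sum s (fun w => \sum_(i <- r) g i w) v = \sum_(i <- r) box_sum s (g i) v.
Proof.
elim: s v => //= j s IH v; rewrite exchange_big /=.
by apply: eq_bigr => a _; rewrite IH.
Qed.

Let box_sum0 s v : box_sum s (fun=> 0) v = 0.
Proof. by elim: s v => //= j s IH v; rewrite big1. Qed.

Let box_sum_set s g j a v : j \notin s ->
  box_sum s g (set_coord j a v) = box_sum s (g \o set_coord j a) v.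
Proof.
elim: s v => //= i s IH v; rewrite inE negb_or => /andP[ji js].
by apply: eq_bigr => b _; rewrite set_coordC 1?eq_sym// IH.
Qed.

Let telescope_F2 (h : nat -> F2) : \sum_(a < N) (h a.+1 + h a) = h N + h 0%N.
Proof.
elim: N => [|n IH]; first by rewrite big_ord0 addF2.
by rewrite big_ord_recr /= IH addrACA [h n + _]addrC addrACA addF2 addr0 addrC.
Qed.

(** Stokes in a single direction: interior facets orthogonal to [j] are counted twice, so only the
    two outer faces of the box survive. *)
Let box_sum_telescope s j (h : (nat -> nat) -> F2) v : uniq s -> j \in s ->
  box_sum s (fun w => h (bump_coord j w) + h w) v =
  box_sum (del j s) (fun w => h (set_coord j N w) + h (set_coord j 0%N w)) v.
Proof.
elim: s v => //= i s IH v /andP[iNs us]; rewrite inE => /orP[/eqP ->|js].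
  rewrite eqxx /= (_ : del i s = s); last first.
    by apply/all_filterP/allP => k ks; apply: contraNneq iNs => <-.
  under eq_bigr do rewrite box_sum_set//.
  transitivity (\sum_(a < N) box_sum s (fun w =>
    h (set_coord i a.+1 w) + h (set_coord i a w)) v).
    apply: eq_bigr => a _; apply: eq_box_sum => w /=.
    by rewrite /bump_coord set_coordK /set_coord eqxx.
  rewrite -box_sum_sum; apply: eq_box_sum => w.
  exact: (telescope_F2 (fun a => h (set_coord i a w))).
have ij : i != j by apply: contraNneq iNs => ->.
by rewrite ij /=; apply: eq_bigr => a _; rewrite IH.
Qed.

Variable lab : nat -> (nat -> nat) -> F2.

(** No edge path in the directions [s] leaves the face where coordinate [j] equals [c]; there
    [lab j] is constant, so the factor given by its coboundary vanishes. *)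
Let cup_face_eq0 l s j c b v : j \in l -> j \notin s ->
  (forall w, w j = c -> lab j w = b) -> v j = c ->
  cup (map lab l) s v = 0.
Proof.
move=> + + labj; elim: l s v => // k l IH s v + jNs vj.
rewrite inE => kl; rewrite [map _ _]/= /=; rewrite big_seq big1// => i si.
have ji : j == i = false by apply: contraNF jNs => /eqP ->.
have bj : bump_coord i v j = c by rewrite /bump_coord /set_coord ji.
have [jk|jk] := eqVneq j k; first by rewrite -jk !labj// addF2 mul0r.
rewrite IH ?mulr0//; first by move: kl; rewrite (negbTE jk).
by rewrite mem_filter (negbTE jNs) andbF.
Qed.

(* By Stokes, only the face where the first coordinate equals [N] contributes;
   there the product of the remaining labels is handled by induction. *)
Lemma box_sum_cup s v : uniq s ->
  (forall j w, j \in s -> w j = 0%N -> lab j w = 0) ->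
  (forall j w, j \in s -> w j = N -> lab j w = 1) ->
  box_sum s (cup (map lab s) s) v = 1.
Proof.
elim: s v => // m s IH v us lab0 labN.
set S := m :: s; have [mNs us'] := andP us.
have sE : del m S = s.
  rewrite /= eqxx /=; apply/all_filterP/allP => k ks.
  by apply: contraNneq mNs => <-.
set K := fun t w => lab m w * cup (map lab s) t w.
transitivity (\sum_(j <- S) box_sum (del j S)
    (fun w => K (del j S) (set_coord j N w) + K (del j S) (set_coord j 0%N w)) v).
  rewrite [LHS](eq_box_sum _ _ _ _ (cup_cons _ _ S)) box_sum_sum big_seq [RHS]big_seq.
  by apply: eq_bigr => j jS; rewrite (box_sum_telescope _ _ (K (del j S))).
rewrite big_cons [X in _ + X]big_seq [X in _ + X]big1 ?addr0; last first.
  move=> j js; rewrite -[RHS](box_sum0 (del j S) v); apply: eq_box_sum => w.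
  have jS : j \in S by rewrite inE js orbT.
  have jN : j \notin del j S by rewrite mem_filter /= eqxx.
  rewrite /K (cup_face_eq0 _ _ _ N 1 _ js jN); last 2 first.
  - by move=> w' ?; exact: labN.
  - by rewrite /set_coord eqxx.
  rewrite (cup_face_eq0 _ _ _ 0%N 0 _ js jN); last 2 first.
  - by move=> w' ?; exact: lab0.
  - by rewrite /set_coord eqxx.
  by rewrite !mulr0 addr0.
rewrite sE; transitivity (box_sum s (cup (map lab s) s \o set_coord m N) v).
  apply: eq_box_sum => w; rewrite /K /= labN ?mul1r; last 2 first.
  - exact: mem_head.
  - by rewrite /set_coord eqxx.
  by rewrite lab0 ?mul0r ?addr0 ?mem_head// /set_coord eqxx.
rewrite -box_sum_set//; apply: IH => // j w js; [apply: lab0|apply: labN];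
  by rewrite inE js orbT.
Qed.

Lemma box_sum_neq0 s g v : box_sum s g v != 0 ->
  exists2 w, g w != 0 & forall i, i \in s -> (w i < N)%N.
Proof.
suff H : box_sum s g v != 0 -> exists2 w, g w != 0 &
    (forall i, i \in s -> (w i < N)%N) /\ forall i, i \notin s -> w i = v i.
  by case/H => w gw [wN _]; exists w.
elim: s v => [|j s IH] v /=; first by exists v.
move=> sn0; have [a _ an0] : exists2 a : 'I_N, true & box_sum s g (set_coord j a v) != 0.
  apply: contrapT => H; move/eqP: sn0; apply; apply: big1 => a _.
  by apply/eqP/negPn/negP => ?; apply: H; exists a.
have [w gw [wN wv]] := IH _ an0; exists w => //; split=> i.
  rewrite inE; have [iss _|iNs /orP[/eqP ->|//]] := boolP (i \in s).
    exact: wN.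
  have [js|js] := boolP (j \in s); first exact: wN.
  by rewrite wv// /set_coord eqxx.
by rewrite inE negb_or => /andP[ij /wv ->]; rewrite /set_coord (negbTE ij).
Qed.

(** Some monotone edge path from [v] has a nonzero product of increments, so each label changes
    along one of its edges. *)
Lemma cup_neq0 l s v : cup (map lab l) s v != 0 ->
  forall k, k \in l -> exists w w',
  [/\ forall i, (v i <= w i <= (v i).+1)%N, forall i, (v i <= w' i <= (v i).+1)%N
    & lab k w != lab k w'].
Proof.
(* The sharper bound records that a path moves at most once in each direction; the induction needs
   it to stay inside the original cube. *)
suff H : cup (map lab l) s v != 0 -> forall k, k \in l -> exists w w',
  [/\ forall i, (v i <= w i <= v i + (i \in s))%N,
      forall i, (v i <= w' i <= v i + (i \in s))%N & lab k w != lab k w'].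
  move=> /H{}H k /H[w [w' [ww ww' kk]]]; exists w, w'; split=> // i.
    by have := ww i; case: (_ \in _); lia.
  by have := ww' i; case: (_ \in _); lia.
elim: l s v => //= k0 l IH s v sn0 k kl.
have [j js jn0] : exists2 j, j \in s &
    (lab k0 (bump_coord j v) + lab k0 v) * cup (map lab l) (del j s) (bump_coord j v) != 0.
  apply: contrapT => H; move/eqP: sn0; apply; rewrite big_seq; apply: big1 => a js.
  by apply/eqP/negPn/negP => ?; apply: H; exists a.
move: jn0; rewrite mulf_eq0 negb_or => /andP[dk cn0].
move: kl; rewrite inE => /orP[/eqP ->|/(IH _ _ cn0 k)[w [w' [ww ww' kk]]]].
  exists (bump_coord j v), v; split=> [i|i|].
  - by rewrite /bump_coord /set_coord; case: eqVneq => [->|_]; rewrite ?js; lia.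
  - lia.
  - by apply: contraNneq dk => ->; rewrite addF2.
have aux u : (forall i, (bump_coord j v i <= u i <= bump_coord j v i + (i \in (del j s)))%N) ->
    forall i, (v i <= u i <= v i + (i \in s))%N.
  move=> uu i; have := uu i; rewrite /bump_coord /set_coord mem_filter.
  by case: eqVneq => [->|_] /=; rewrite ?js; lia.
by exists w, w'; split=> //; exact: aux.
Qed.

End Kuhn.

(** The cup product of the label coboundaries sums to 1 over the box, so it is nonzero on some unit
    cube, and there every label takes both values. *)
Lemma kuhn_cubical_sperner (n N : nat) (lab : nat -> (nat -> nat) -> bool) :
  (forall j w, (j < n)%N -> w j = 0%N -> lab j w = false) ->
  (forall j w, (j < n)%N -> w j = N -> lab j w = true) ->
  exists2 v : nat -> nat, (forall i, (i < n)%N -> (v i < N)%N) &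
    forall k, (k < n)%N -> exists w w',
    [/\ forall i, (v i <= w i <= (v i).+1)%N, forall i, (v i <= w' i <= (v i).+1)%N
      & lab k w != lab k w'].
Proof.
move=> lab0 labN; pose lab2 k w : 'F_2 := (lab k w)%:R.
have H : box_sum N (iota 0 n) (cup (map lab2 (iota 0 n)) (iota 0 n)) (fun=> 0%N) = 1.
  apply: box_sum_cup => [|j w|j w]; first exact: iota_uniq.
    by rewrite mem_iota /= add0n => jn w0; rewrite /lab2 lab0.
  by rewrite mem_iota /= add0n => jn wN; rewrite /lab2 labN.
have [v cn0 vN] := box_sum_neq0 N (iota 0 n) (cup (map lab2 (iota 0 n)) (iota 0 n))
  (fun=> 0%N) ltac:(by rewrite H).
exists v => [i ilt|k klt]; first by apply: vN; rewrite mem_iota.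
have [|w [w' [ww ww' ne]]] := cup_neq0 lab2 _ _ _ cn0 k; first by rewrite mem_iota.
exists w, w'; split=> //; apply: contraNneq ne; rewrite /lab2 => ->; exact: eqxx.
Qed.

(** * Schauder's theorem for equicontinuous functions *)

Section UniformConvergence.
Context {R : realType} {S : Type}.
Implicit Types (X Y : S -> R).

Definition unif_cvg (X_ : nat -> S -> R) X := forall e : R, 0 < e ->
  exists N, forall n, (N <= n)%N -> forall s, `|X_ n s - X s| <= e.

Lemma natSinv_lt (e : R) : 0 < e ->
  exists N, forall n, (N <= n)%N -> n.+1%:R^-1 < e.
Proof.
move=> e0; have [N _ HN] := near_infty_natSinv_lt (PosNum e0).
by exists N => n Nn; apply: HN.
Qed.

Lemma unif_cvg_dist (X_ Y_ : nat -> S -> R) X :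
  unif_cvg X_ X -> (forall n s, `|X_ n s - Y_ n s| <= n.+1%:R^-1) ->
  unif_cvg Y_ X.
Proof.
move=> XX XY e e0; have [N1 H1] := XX (e / 2) ltac:(lra).
have [N2 H2] := natSinv_lt (e / 2) ltac:(lra).
exists (maxn N1 N2) => n; rewrite geq_max => /andP[n1 n2] s.
have := H1 n n1 s; have := H2 n n2; have := XY n s; move: (n.+1%:R^-1) => c.
by rewrite !ler_distl => /andP[? ?] ? /andP[? ?]; apply/andP; split; lra.
Qed.

Lemma ultra_limit (U : set_system nat) (B : R) (u : nat -> R) :
  UltraFilter U -> (forall n, `|u n| <= B) ->
  exists l, forall e, 0 < e -> U [set n | `|u n - l| <= e].
Proof.
move=> UU uB; have [l [_ lcl]] : exists l, (`[- B, B] `&` cluster (u @ U)) l.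
  apply: (@segment_compact R (- B) B (u @ U)); apply: (@filterE _ U) => n.
  by rewrite /= in_itv /= -ler_norml.
exists l => e e0; have [//|Un] := in_ultra_setVsetC [set n | `|u n - l| <= e] UU.
have [] := lcl [set y | ~ `|y - l| <= e] (ball l e) _ (nbhsx_ballx l e e0).
  by [].
move=> y [/= + /ltW]; by rewrite distrC.
Qed.

End UniformConvergence.

Section Schauder.
Context {R : realType} {S : Type}.
Variables (kap : S -> R) (L B : R) (s0 : S).
Hypothesis kapL : forall s, `|kap s| <= L.
Hypothesis B0 : 0 < B.
Implicit Types (X Y : S -> R).

(** A uniformly bounded, equicontinuous family: maps are 1-Lipschitz for the pseudometric
    [|kap s - kap t|], which is totally bounded because [kap] is bounded. *)
Definition lip_ball X :=
  (forall s, `|X s| <= B) /\ (forall s t, `|X s - X t| <= `|kap s - kap t|).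

(** Cut [[- L, L]] into cells of length [e] and choose one point of [S] over each cell that [kap]
    meets. *)
Lemma finite_net (e : R) : 0 < e -> exists m (pt : nat -> S),
  forall s, exists2 i, (i < m)%N & `|kap s - kap (pt i)| <= e.
Proof.
move=> e0; pose cell s := Num.trunc ((kap s + L) / e).
have k0 s : 0 <= (kap s + L) / e.
  by apply: divr_ge0; [move: (kapL s); rewrite ler_norml => /andP[? ?]; lra|lra].
have [pt Hpt] : {pt : nat -> S & forall i, (exists s, cell s = i) -> cell (pt i) = i}.
  apply: (@choice _ _ (fun i t => (exists s, cell s = i) -> cell t = i)) => i.
  have [[s <-]|H] := pselect (exists s, cell s = i); first by exists s.
  by exists s0 => /H.
exists (Num.trunc ((L + L) / e)).+1, pt => s; exists (cell s).
  rewrite ltnS; apply: le_truncn; rewrite ler_pM2r ?invr_gt0// lerD2r.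
  exact: le_trans (ler_norm _) (kapL s).
have ce : cell (pt (cell s)) = cell s by apply: Hpt; exists s.
have := truncn_itv (k0 s); have := truncn_itv (k0 (pt (cell s))).
rewrite -/(cell _) -/(cell s) ce.
rewrite !ler_pdivlMr// !ltr_pdivrMr// -natr1 mulrDl mul1r.
move=> /andP[? ?] /andP[? ?]; rewrite ler_distl; apply/andP; split; lra.
Qed.

(* Arzela-Ascoli, with the limit taken along an ultrafilter on the indices. *)
Lemma lip_ball_compact (X_ : nat -> S -> R) : (forall n, lip_ball (X_ n)) ->
  exists (phi : nat -> nat) X, [/\ forall n, (n <= phi n)%N, lip_ball X
    & unif_cvg (X_ \o phi) X].
Proof.
move=> DX; have [U [UU sU]] := ultraFilterLemma (F := \oo) _.
have /choice[X HX] : forall s, exists l, forall e, 0 < e -> U [set n | `|X_ n s - l| <= e].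
  by move=> s; apply: (ultra_limit U B) => n; case: (DX n).
(* Finitely many members of the ultrafilter meet, so one arbitrarily late index serves a whole
   finite net. *)
have approx (m : nat) (pt : nat -> S) e N : 0 < e ->
    exists2 n, (N <= n)%N & forall i, (i < m)%N -> `|X_ n (pt i) - X (pt i)| <= e.
  move=> e0; have UN : U [set n | (N <= n)%N] by apply: sU; exists N.
  have Um : U [set n | forall i : 'I_m, `|X_ n (pt i) - X (pt i)| <= e].
    by apply: filter_forall => i; exact: HX.
  have [n [Nn Hn]] := filter_ex (filterI UN Um).
  by exists n => // i im; exact: (Hn (Ordinal im)).
have DXl : lip_ball X.
  split=> [s|s t]; apply/ler_addgt0Pr => e e0.
    have [n _ /(_ 0%N erefl)] := approx 1%N (fun=> s) e 0%N e0.
    have := (DX n).1 s; rewrite ler_distl !ler_norml.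
    by move=> /andP[? ?] /andP[? ?]; apply/andP; split; lra.
  have [n _ H] := approx 2%N (fun i => if i is 0%N then s else t) (e / 2) 0%N ltac:(lra).
  have := (DX n).2 s t; have := H 0%N erefl; have := H 1%N erefl.
  rewrite !ler_distl.
  by move=> /andP[? ?] /andP[? ?] /andP[? ?]; apply/andP; split; lra.
have /choice[phi Hphi] : forall n, exists k,
    (n <= k)%N /\ forall s, `|X_ k s - X s| <= n.+1%:R^-1.
  move=> n; set e := n.+1%:R^-1; have e0 : 0 < e by rewrite invr_gt0.
  have [m [pt Hpt]] := finite_net (e / 3) ltac:(lra).
  have [k nk Hk] := approx m pt (e / 3) n ltac:(lra).
  exists k; split=> // s; have [i im si] := Hpt s; have := Hk i im.
  have := le_trans ((DX k).2 s (pt i)) si.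
  have := le_trans (DXl.2 s (pt i)) si; rewrite !ler_distl.
  by move=> /andP[? ?] /andP[? ?] /andP[? ?]; apply/andP; split; lra.
exists phi, X; split=> //; first by move=> n; case: (Hphi n).
move=> e e0; have [N HN] := natSinv_lt _ e0; exists N => n Nn s.
exact: le_trans ((Hphi n).2 s) (ltW (HN n Nn)).
Qed.

Variable f : (S -> R) -> (S -> R).
Hypothesis fD : forall X, lip_ball X -> lip_ball (f X).
Hypothesis fC : forall (X_ : nat -> S -> R) X, (forall n, lip_ball (X_ n)) -> lip_ball X ->
  unif_cvg X_ X -> unif_cvg (f \o X_) (f X).

(** Heine-Cantor by compactness: ever closer pairs that violate the bound would have a common limit
    along a subsequence, against [fC]. *)
Lemma lip_ball_unif_continuous (e : R) : 0 < e -> exists2 d, 0 < d &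
  forall X Y, lip_ball X -> lip_ball Y -> (forall s, `|X s - Y s| <= d) ->
    forall s, `|f X s - f Y s| <= e.
Proof.
move=> e0; apply: contrapT => H.
have /choice[XY HXY] : forall n : nat, exists XY : (S -> R) * (S -> R),
    [/\ lip_ball XY.1, lip_ball XY.2, forall s, `|XY.1 s - XY.2 s| <= n.+1%:R^-1
      & exists s, ~ `|f XY.1 s - f XY.2 s| <= e].
  move=> n; apply: contrapT => Hn; apply: H; exists n.+1%:R^-1; first by rewrite invr_gt0.
  move=> X Y DX DY XY s; apply: contrapT => XYs; apply: Hn; exists (X, Y).
  by split=> //; exists s.
have [phi [X [phin DX cX]]] := lip_ball_compact (fun n => (XY n).1)
  (fun n => let: And4 a _ _ _ := HXY n in a).
have cY : unif_cvg (fun n => (XY (phi n)).2) X.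
  apply: (unif_cvg_dist _ _ _ cX) => n s /=.
  have [_ _ /(_ s) H1 _] := HXY (phi n); apply: le_trans H1 _.
  by rewrite lef_pV2 ?posrE// ler_nat ltnS phin.
have [|N1 H1] := fC _ _ _ DX cX (e / 2) ltac:(lra); first by move=> n; case: (HXY (phi n)).
have [|N2 H2] := fC _ _ _ DX cY (e / 2) ltac:(lra); first by move=> n; case: (HXY (phi n)).
have [_ _ _ [s]] := HXY (phi (maxn N1 N2)); apply.
have := H1 _ (leq_maxl N1 N2) s; have := H2 _ (leq_maxr N1 N2) s.
rewrite /= !ler_distl => /andP[? ?] /andP[? ?]; apply/andP; split; lra.
Qed.

(* The largest map in the ball that is dominated by [z i] at [pt i]. *)
Definition mcshane (m : nat) (pt : nat -> S) (z : nat -> R) : S -> R := fun t =>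
  \big[Num.min/B]_(i < m) (z i + `|kap t - kap (pt i)|).

Section mcshane.
Variables (m : nat) (pt : nat -> S).
Implicit Type z : nat -> R.

Let le_mcshane z z' s t c : 0 <= c ->
  (forall i, (i < m)%N ->
    z i + `|kap s - kap (pt i)| - c <= z' i + `|kap t - kap (pt i)|) ->
  mcshane m pt z s - c <= mcshane m pt z' t.
Proof.
move=> c0 H; apply/bigmin_geP; split=> [|i _].
  have := bigmin_le_id (index_enum 'I_m) B xpredT
    (fun i : 'I_m => z i + `|kap s - kap (pt i)|).
  by rewrite -/(mcshane m pt z s); lra.
apply: le_trans (H i (ltn_ord i)); rewrite lerD2r.
exact: (bigmin_le_cond B (fun i : 'I_m => z i + `|kap s - kap (pt i)|)).
Qed.

Lemma mcshane_le z i : (i < m)%N -> mcshane m pt z (pt i) <= z i.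
Proof.
move=> im; have := bigmin_le_cond B (fun j : 'I_m => z j + `|kap (pt i) - kap (pt j)|)
  (isT : xpredT (Ordinal im)).
by rewrite /= subrr normr0 addr0.
Qed.

Lemma mcshane_ge z t c : c <= B ->
  (forall i, (i < m)%N -> c <= z i + `|kap t - kap (pt i)|) ->
  c <= mcshane m pt z t.
Proof. by move=> cB H; apply/bigmin_geP; split=> // i _; exact: H. Qed.

Lemma mcshane_lip_ball z : (forall i, - B <= z i) -> lip_ball (mcshane m pt z).
Proof.
have BB : - B <= B by have := B0; lra.
move=> zB; split=> [s|s t].
  rewrite ler_norml bigmin_le_id andbT; apply: mcshane_ge => //.
  by move=> i _; apply: ler_wpDr.
have aux a b : mcshane m pt z a - `|kap a - kap b| <= mcshane m pt z b.
  apply: le_mcshane => // i _.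
  by have := ler_distD (kap b) (kap a) (kap (pt i)); lra.
have := aux s t; have := aux t s; rewrite [`|kap t - _|]distrC ler_distl => ? ?.
by apply/andP; split; lra.
Qed.

Lemma mcshane_dist z z' c : 0 <= c -> (forall i, `|z i - z' i| <= c) ->
  forall s, `|mcshane m pt z s - mcshane m pt z' s| <= c.
Proof.
move=> c0 zz s; have zz' i := zz i; rewrite ler_distl.
apply/andP; split; last rewrite -lerBlDr; apply: le_mcshane => // i _;
  by have := zz i; rewrite ler_distl => /andP[? ?]; lra.
Qed.

End mcshane.

(** A vertex [w] of a grid prescribes values at a finite net, and [mcshane] extends them to a map of
    the ball. Label [i] tells whether [f] lowers or raises the value at node [i]; in a cell where
    every label changes, [f] nearly fixes all nodal values. *)
Lemma approx_fixed_point (e : R) : 0 < e ->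
  exists2 X, lip_ball X & forall s, `|X s - f X s| <= e.
Proof.
have Bgt0 : 0 < B := B0.
move=> e0; have [d d0 Hd] := lip_ball_unif_continuous (e / 4) ltac:(lra).
have [m [pt Hpt]] := finite_net (e / 8) ltac:(lra).
pose c := Num.min d (e / 4); have c0 : 0 < c by rewrite lt_min d0; lra.
have [N' HN'] := natSinv_lt (c / (2 * B)) ltac:(by apply: divr_gt0; lra).
pose N := N'.+1; have N0 : 0 < N%:R :> R by rewrite ltr0n.
pose h := 2 * B / N%:R.
have h0 : 0 < h by apply: divr_gt0; lra.
have hc : h <= c.
  by have := ltW (HN' N' (leqnn _)); rewrite ler_pdivlMr; last lra; rewrite mulrC.
have hd : h <= d by apply: le_trans hc _; rewrite ge_min lexx.
have he : h <= e / 4 by apply: le_trans hc _; rewrite ge_min lexx orbT.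
(* [minn] keeps the values in [[- B, B]] also for the coordinates [i >= m], which Kuhn's lemma
   leaves free. *)
pose z (w : nat -> nat) i := - B + h * (minn (w i) N)%:R.
have zN w i : (N <= w i)%N -> z w i = B.
  by move=> Nw; rewrite /z (minn_idPr Nw) /h divfK ?gt_eqF//; lra.
have zB w i : - B <= z w i by rewrite /z lerDl mulr_ge0// ltW.
pose r w := mcshane m pt (z w); have Dr w : lip_ball (r w) by exact: mcshane_lip_ball.
(* Labels are forced on the two outer faces, as Kuhn's lemma requires. This agrees with the
   comparison elsewhere: [f (r w)] lies between [- B] and [B], the values of [z] on these faces. *)
pose lab i w := (w i != 0%N) && ((N <= w i)%N || (f (r w) (pt i) <= z w i)).
have [||v vN Hv] := kuhn_cubical_sperner m N lab.
- by move=> j w _ wj; rewrite /lab wj.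
- by move=> j w _ wj; rewrite /lab wj leqnn.
have near_v w : (forall i, v i <= w i <= (v i).+1)%N ->
    (forall i, `|z w i - z v i| <= h) /\ forall s, `|f (r w) s - f (r v) s| <= e / 4.
  move=> vw; have zz i : `|z w i - z v i| <= h.
    rewrite /z opprD addrACA subrr add0r -mulrBr normrM (gtr0_norm h0).
    rewrite -[leRHS]mulr1 ler_pM2l// ler_norml.
    have /andP[] : (minn (v i) N <= minn (w i) N <= (minn (v i) N).+1)%N.
      by have := vw i; lia.
    by rewrite -!(ler_nat R) -natr1; move=> ? ?; apply/andP; split; lra.
  split=> //; apply: Hd => // s; apply: le_trans hd.
  by apply: mcshane_dist => //; exact: ltW.
(* [f] is at most [z] at the vertex labelled true and at least [z] at the other one. Passing to [v]
   changes each of the two quantities by at most [e / 4]. *)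
have fz i : (i < m)%N -> `|f (r v) (pt i) - z v i| <= e / 2.
  move=> im; have [w [w' [vw vw' ne]]] := Hv i im.
  wlog labw : w w' vw vw' ne / lab i w.
    move=> H; have [lw|lw] := boolP (lab i w); first exact: (H w w').
    by apply: (H w' w) => //; [rewrite eq_sym|move: ne lw; do 2 case: (lab _ _)].
  have labw' : ~~ lab i w' by move: ne labw; do 2 case: (lab _ _).
  have zf : f (r w) (pt i) <= z w i.
    move: labw => /andP[_ /orP[Nw|//]]; rewrite (zN _ _ Nw).
    exact: le_trans (ler_norm _) ((fD _ (Dr w)).1 _).
  have fz' : z w' i <= f (r w') (pt i).
    move: labw'; rewrite negb_and negbK => /orP[/eqP w0|].
      rewrite /z w0 min0n mulr0 addr0.
      by have := (fD _ (Dr w')).1 (pt i); rewrite ler_norml => /andP[].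
    by rewrite negb_or -ltNge => /andP[_ /ltW].
  have [/(_ i) + /(_ (pt i)) +] := near_v w vw.
  have [/(_ i) + /(_ (pt i)) +] := near_v w' vw'.
  rewrite !ler_distl => /andP[? ?] /andP[? ?] /andP[? ?] /andP[? ?].
  by apply/andP; split; lra.
exists (r v) => // s; have [i im si] := Hpt s.
(* The nodal values [z v] need not be 1-Lipschitz, so [r v] may drop below them. It stays above
   [f (r v) - e / 2] at the nodes because [f (r v)] is 1-Lipschitz and within [e / 2] of [z v]. *)
have rf : `|r v (pt i) - f (r v) (pt i)| <= e / 2.
  have Df := fD _ (Dr v).
  have := fz i im; rewrite !ler_distl => /andP[H1 H2]; apply/andP; split; last first.
    by apply: le_trans (mcshane_le _ _ _ _ im) _; lra.
  apply: mcshane_ge => [|j jm].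
    by have := Df.1 (pt i); rewrite ler_norml => /andP[? ?]; lra.
  have := Df.2 (pt i) (pt j); have := fz j jm.
  by rewrite !ler_distl => /andP[? ?] /andP[? ?]; lra.
have := le_trans ((Dr v).2 s (pt i)) si; have := le_trans ((fD _ (Dr v)).2 s (pt i)) si.
move: rf; rewrite !ler_distl => /andP[? ?] /andP[? ?] /andP[? ?].
by apply/andP; split; lra.
Qed.

(** Approximate fixed points accumulate by compactness, and continuity makes the limit an exact
    one. *)
Theorem schauder_lip_ball : exists2 X, lip_ball X & forall s, f X s = X s.
Proof.
have /choice[X_ HX_] : forall n : nat, exists X,
    lip_ball X /\ forall s, `|X s - f X s| <= n.+1%:R^-1.
  by move=> n; have [|X] := approx_fixed_point n.+1%:R^-1; [rewrite invr_gt0|exists X].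
have DX n : lip_ball (X_ n) by case: (HX_ n).
have [phi [X [phin DXl cX]]] := lip_ball_compact X_ DX.
have cf := fC (X_ \o phi) X (fun n => DX (phi n)) DXl cX.
have cfX : unif_cvg (f \o (X_ \o phi)) X.
  apply: (unif_cvg_dist _ _ _ cX) => n s /=; apply: le_trans ((HX_ (phi n)).2 s) _.
  by rewrite lef_pV2 ?posrE// ler_nat ltnS phin.
exists X => // s; apply/eqP; rewrite -subr_eq0 -normr_le0; apply/ler_addgt0Pr => e e0.
have [N1 H1] := cf (e / 2) ltac:(lra); have [N2 H2] := cfX (e / 2) ltac:(lra).
have := H1 _ (leq_maxl N1 N2) s; have := H2 _ (leq_maxr N1 N2) s.
rewrite add0r /= !ler_distl => /andP[? ?] /andP[? ?]; apply/andP; split; lra.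
Qed.

End Schauder.

(** * Primitives of integrable functions *)

Section Primitive.
Context {R : realType}.
Local Notation mu := (@lebesgue_measure R).
Implicit Types (g k : R -> R) (T : R).

Lemma ae_imp (P Q : R -> Prop) : (forall x, P x -> Q x) ->
  {ae mu, forall x, P x} -> {ae mu, forall x, Q x}.
Proof. by move=> PQ; apply: filterS; first exact: (ae_filter_ringOfSetsType mu). Qed.

(** Based at [-oo], so that it makes sense on the whole line; functions on [Icc T] are extended by
    zero first, and their primitive then vanishes at 0. *)
Definition prim g t := \int[mu]_(s in `]-oo, t]) g s.

Let integrableTS g (D : set R) : measurable D ->
  mu.-integrable setT (EFin \o g) -> mu.-integrable D (EFin \o g).
Proof. by move=> mD; apply: integrableS. Qed.

Lemma le_Rintegral_ae g k (D : set R) : measurable D ->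
  mu.-integrable D (EFin \o g) -> mu.-integrable D (EFin \o k) ->
  (forall t, 0 <= k t) -> {ae mu, forall t, D t -> `|g t| <= k t} ->
  `|\int[mu]_(t in D) g t| <= \int[mu]_(t in D) k t.
Proof.
move=> mD ig ik k0 gk; apply: le_trans (le_normr_Rintegral _ ig) _ => //.
have ing : mu.-integrable D (EFin \o (fun t => `|g t|)).
  exact: (integrable_norm ig).
rewrite fine_le//; [exact: integrable_fin_num|exact: integrable_fin_num|].
apply: ae_ge0_le_integral => //.
- exact: (measurable_int mu ing).
- by move=> t _; rewrite lee_fin.
- exact: (measurable_int mu ik).
Qed.

Lemma primB g s t : mu.-integrable setT (EFin \o g) -> s <= t ->
  prim g t - prim g s = \int[mu]_(r in `]s, t]) g r.
Proof.
move=> ig st; apply: (@Rintegral_itvB _ g -oo%O (BRight t) s); last by rewrite bnd_simp.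
  exact: integrableTS.
by [].
Qed.

Lemma prim_dist g k : mu.-integrable setT (EFin \o g) ->
  mu.-integrable setT (EFin \o k) -> (forall t, 0 <= k t) ->
  {ae mu, forall t, `|g t| <= k t} ->
  forall s t, `|prim g s - prim g t| <= `|prim k s - prim k t|.
Proof.
move=> ig ik k0 gk s t.
wlog st : s t / s <= t.
  move=> H; have [/H//|/ltW ts] := leP s t.
  by rewrite distrC [leRHS]distrC H.
rewrite distrC [leRHS]distrC !primB//; apply: le_trans (ler_norm _).
apply: le_Rintegral_ae => //; [exact: integrableTS|exact: integrableTS|].
by apply: ae_imp gk => x gkx _.
Qed.

Lemma prim_nondecreasing k : mu.-integrable setT (EFin \o k) ->
  (forall t, 0 <= k t) -> {homo prim k : s t / s <= t}.
Proof.
by move=> ik k0 s t st; rewrite -subr_ge0 primB//; apply: Rintegral_ge0.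
Qed.

Lemma prim_bound g k t : mu.-integrable setT (EFin \o g) ->
  mu.-integrable setT (EFin \o k) -> (forall t, 0 <= k t) ->
  {ae mu, forall t, `|g t| <= k t} -> `|prim g t| <= \int[mu]_t k t.
Proof.
move=> ig ik k0 gk; apply: (@le_trans _ _ (prim k t)).
  apply: le_Rintegral_ae => //; [exact: integrableTS|exact: integrableTS|].
  by apply: ae_imp gk => x gkx _.
rewrite fine_le//; try by apply: integrable_fin_num => //; exact: integrableTS.
apply: ge0_subset_integral => //; first exact: (measurable_int mu ik).
by move=> s _; rewrite lee_fin.
Qed.

Lemma prim_continuous k : mu.-integrable setT (EFin \o k) ->
  (forall t, 0 <= k t) -> continuous (prim k).
Proof.
move=> ik k0 t; apply/cvgrPdist_lt => e e0.
have [d [d0 Hd]] := integral_normr_continuous ik e0.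
have main s s' : s <= s' -> s' - s < d -> prim k s' - prim k s < e.
  move=> ss' sd; rewrite primB//.
  rewrite (_ : \int[mu]_(r in _) k r = \int[mu]_(r in `]s, s']) `|k r|); last first.
    by apply: eq_Rintegral => r _; rewrite ger0_norm.
  apply: Hd => //; change (mu (`]s, s']%classic : set R) < d%:E)%E.
  rewrite lebesgue_measure_itv /= lte_fin.
  by case: (s < s'); rewrite ?lte_fin. 
near=> s; have : `|t - s| < d by near: s; exact: cvgr_dist_lt.
rewrite ltr_distl => /andP[? ?].
have nd := prim_nondecreasing _ ik k0.
have [st|/ltW ts] := leP s t.
  rewrite ger0_norm ?subr_ge0 ?nd//; apply: main => //; lra.
rewrite distrC ger0_norm ?subr_ge0 ?nd//; apply: main => //; lra.
Unshelve. all: by end_near. Qed.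

Lemma prim_lip_continuous k (x : R -> R) : mu.-integrable setT (EFin \o k) ->
  (forall t, 0 <= k t) -> (forall s t, `|x s - x t| <= `|prim k s - prim k t|) ->
  continuous x.
Proof.
move=> ik k0 xk t; apply/cvgrPdist_lt => e e0; near=> s.
apply: le_lt_trans (xk t s) _.
by near: s; move/cvgrPdist_lt : (prim_continuous _ ik k0 t); apply.
Unshelve. all: by end_near. Qed.

Lemma integrable_Icc_restrict T g : mu.-integrable (Icc T) (EFin \o g) <->
  mu.-integrable setT (EFin \o (g \_ (Icc T))).
Proof. by rewrite -restrict_EFin; apply: integrable_mkcond; exact: measurable_itv. Qed.

Lemma prim_restrict T g t : 0 <= t <= T ->
  prim (g \_ (Icc T)) t = \int[mu]_(s in Icc t) g s.
Proof.
move=> /andP[t0 tT]; rewrite /prim -Rintegral_mkcondr; congr (Rintegral _ _ _).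
apply/seteqP; split => s; rewrite /Icc /= !in_itv /=; first by move=> [-> /andP[->]].
by move=> /andP[s0 st]; rewrite st s0 (le_trans st tT).
Qed.

Lemma prim_restrict0 T g : prim (g \_ (Icc T)) 0 = 0.
Proof.
rewrite /prim -Rintegral_mkcondr -[RHS](Rintegral_set1 g 0).
have [T0|T0] := leP 0 T.
  congr (Rintegral _ _ _); apply/seteqP; split => s; rewrite /Icc /= !in_itv /=.
    by move=> [? /andP[? _]]; apply/eqP; rewrite eq_le; apply/andP; split.
  by move=> ->; rewrite lexx T0.
rewrite Rintegral_set1 (_ : _ `&` _ = set0) ?Rintegral_set0//.
by apply/seteqP; split => s //; rewrite /Icc /= !in_itv /=; move=> [? /andP[]]; lra.
Qed.

End Primitive.

(** * Densities of functions dominated by a primitive *)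

Section LipschitzPrimitive.
Context {R : realType}.
Local Notation mu := (@lebesgue_measure R).

Lemma lebesgue_stieltjes_itv (f : cumulative R R) (a b : R) : a <= b ->
  lebesgue_stieltjes_measure f `]a, b]%classic = (f b - f a)%:E.
Proof.
move=> ab; rewrite /lebesgue_stieltjes_measure /measure_extension /=.
by rewrite measurable_mu_extE /=; [rewrite wlength_itv_bnd|exact: is_ocitv].
Qed.

Variables (k x : R -> R).
Hypothesis ik : mu.-integrable setT (EFin \o k).
Hypothesis k0 : forall t, 0 <= k t.
Hypothesis xk : forall s t, `|x s - x t| <= `|prim k s - prim k t|.

Let K := prim k.

Let K_nd : {homo K : s t / s <= t}.
Proof. exact: prim_nondecreasing. Qed.

Let K_cont : continuous K.
Proof. exact: prim_continuous. Qed.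

Let x_cont : continuous x.
Proof. exact: prim_lip_continuous ik k0 xk. Qed.

Let xK s t : s <= t -> `|x t - x s| <= K t - K s.
Proof. by move=> st; rewrite (le_trans (xk t s))// ger0_norm// subr_ge0 K_nd. Qed.

(** With [K = prim k], the domination by [K] makes [K + x] and [K - x] nondecreasing, so each has a
    Stieltjes measure; the two add up to that of [2 K], which has density [2 k]. *)
Definition upper_part : R -> R := fun t => prim k t + x t.
Definition lower_part : R -> R := fun t => prim k t - x t.
Definition total_part : R -> R := fun t => prim k t + prim k t.

Let up_nd : {homo upper_part : s t / s <= t}.
Proof.
by move=> s t /xK; rewrite /upper_part -/K ler_norml => /andP[? ?]; lra.
Qed.

Let low_nd : {homo lower_part : s t / s <= t}.
Proof.
by move=> s t /xK; rewrite /lower_part -/K ler_norml => /andP[? ?]; lra.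
Qed.

Let tot_nd : {homo total_part : s t / s <= t}.
Proof. by move=> s t /K_nd H; apply: lerD. Qed.

Let up_rc : right_continuous upper_part.
Proof. by apply/right_continuousW => t; apply: cvgD; [exact: K_cont|exact: x_cont]. Qed.

Let low_rc : right_continuous lower_part.
Proof. by apply/right_continuousW => t; apply: cvgB; [exact: K_cont|exact: x_cont]. Qed.

Let tot_rc : right_continuous total_part.
Proof. by apply/right_continuousW => t; apply: cvgD; exact: K_cont. Qed.

#[local] HB.instance Definition _ := isCumulative.Build R _ R upper_part up_nd up_rc.
#[local] HB.instance Definition _ := isCumulative.Build R _ R lower_part low_nd low_rc.
#[local] HB.instance Definition _ := isCumulative.Build R _ R total_part tot_nd tot_rc.

Definition twice_density (A : set (measurableTypeR R)) :=
  (\int[mu]_(t in A) (k t + k t)%:E)%E.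

Let i2k : mu.-integrable setT (EFin \o (fun t => k t + k t)).
Proof. by apply: (integrableD _ ik ik). Qed.

Let td0 : twice_density set0 = 0%E.
Proof. by rewrite /twice_density integral_set0. Qed.

Let td_ge0 A : (0 <= twice_density A)%E.
Proof. by apply: integral_ge0 => t _; rewrite lee_fin addr_ge0. Qed.

Let td_sigma : semi_sigma_additive twice_density.
Proof.
apply: semi_sigma_additive_nng_induced; first exact: (measurable_int mu i2k).
by move=> t; rewrite lee_fin addr_ge0.
Qed.

#[local] HB.instance Definition _ := isMeasure.Build _ _ _ twice_density td0 td_ge0 td_sigma.

Let LS_total A : measurable A ->
  lebesgue_stieltjes_measure total_part A = twice_density A.
Proof.
move=> mA; apply: lebesgue_stieltjes_measure_unique => // _ [[a b]] _ <- /=.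
have [ab|/ltW ba] := leP a b; last first.
  by rewrite set_itv_ge ?measure0// bnd_simp -leNgt.
rewrite lebesgue_stieltjes_itv//.
have iab : mu.-integrable `]a, b] (EFin \o k) by apply: integrableS ik.
have -> : total_part b - total_part a = \int[mu]_(t in `]a, b]) (k t + k t).
  rewrite RintegralD// -primB// /total_part; ring.
rewrite fineK//; apply: integrable_fin_num => //; exact: integrableS i2k.
Qed.

Let LS_add A : measurable A -> lebesgue_stieltjes_measure total_part A =
  (lebesgue_stieltjes_measure upper_part A + lebesgue_stieltjes_measure lower_part A)%E.
Proof.
move=> mA; rewrite -measure_addE.
apply: lebesgue_stieltjes_measure_unique => // _ [[a b]] _ <-.
rewrite [RHS]measure_addE /=.
have [ab|/ltW ba] := leP a b; last first.
  by rewrite set_itv_ge ?measure0 ?adde0// bnd_simp -leNgt.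
rewrite !lebesgue_stieltjes_itv// -EFinD; congr EFin.
rewrite /= /total_part /upper_part /lower_part; ring.
Qed.

(** Drop the nonnegative measure of [K - x]. The bound gives both finiteness and absolute continuity
    of the measure of [K + x]. *)
Let up_le A : measurable A -> (lebesgue_stieltjes_measure upper_part A <= twice_density A)%E.
Proof. by move=> mA; rewrite -LS_total// LS_add// leeDl. Qed.

Definition upper_measure := lebesgue_stieltjes_measure upper_part.
HB.instance Definition _ := Measure.on upper_measure.

Let up_fin : fin_num_fun upper_measure.
Proof.
move=> A mA; rewrite ge0_fin_numE//; apply: le_lt_trans (up_le A mA) _.
rewrite -ge0_fin_numE//; apply: integrable_fin_num => //; exact: integrableS i2k.
Qed.

HB.instance Definition _ := @Measure_isFinite.Build _ _ _ upper_measure up_fin.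

Let up_dom : upper_measure `<< mu.
Proof.
apply/null_content_dominatesP => A mA muA; apply/eqP; rewrite eq_le measure_ge0 andbT.
apply: le_trans (up_le A mA) _; rewrite /twice_density null_set_integral//.
by apply: (measurable_funS _ _ (measurable_int mu i2k)).
Qed.

(* [k + x'] is the Radon-Nikodym density of the Stieltjes measure of
   [prim k + x], which is dominated by [2 k]. *)
Lemma lip_prim : exists g, [/\ mu.-integrable setT (EFin \o g),
  {ae mu, forall t, `|g t| <= k t} &
  forall s t, s <= t -> x t - x s = \int[mu]_(r in `]s, t]) g r].
Proof.
have [f [f0 ff fi fE]] := radon_nikodym_sigma_finite up_dom.
have fK t : (fine (f t))%:E = f t by rewrite fineK.
have if' : mu.-integrable setT (EFin \o (fine \o f)).
  by apply: eq_integrable fi => // t _ /=; rewrite fK.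
exists (fun t => fine (f t) - k t); split.
- by apply: (integrableB _ if' ik).
(* On every measurable part of [A] the integral of [f] is at most that of [2 k], while [f > 2 k]
   there. The integrals thus agree, which makes [f = 2 k] almost everywhere on [A], so [A] is null.
   Then [0 <= f <= 2 k] gives [|f - k| <= k]. *)
- pose A := [set t | ((k t + k t)%:E < f t)%E].
  have mA : measurable A.
    rewrite -[A]setTI; apply: measurable_lte => //; first exact: (measurable_int mu i2k).
    exact: (measurable_int mu fi).
  have fA : ae_eq mu A f (fun t => (k t + k t)%:E).
    apply: integral_ae_eq => //.
    - by apply: integrableS fi.
    - by apply: (measurable_funS _ _ (measurable_int mu i2k)).
    move=> E EA mE; apply/eqP; rewrite eq_le; apply/andP; split.
      by rewrite -fE//; exact: up_le.
    apply: ge0_le_integral => //.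
    - by move=> t _; rewrite lee_fin addr_ge0.
    - by apply: (measurable_funS _ _ (measurable_int mu i2k)).
    - by apply: (measurable_funS _ _ (measurable_int mu fi)).
    - by move=> t /EA /ltW.
  apply: ae_imp fA => t; rewrite /A /= => H; rewrite ler_distlC.
  have ft0 : 0 <= fine (f t) by rewrite fine_ge0.
  have [ft|ft] := ltP (k t + k t) (fine (f t)).
    have := H; rewrite -fK lte_fin => /(_ ft)[E]; by move: ft; rewrite E ltxx.
  by apply/andP; split; lra.
- move=> s t st; have ist : mu.-integrable `]s, t] (EFin \o k) by apply: integrableS ik.
  have iff : mu.-integrable `]s, t] (EFin \o (fine \o f)) by apply: integrableS if'.
  rewrite RintegralB// -(primB k)//.
  have -> : \int[mu]_(r in `]s, t]) fine (f r) = upper_part t - upper_part s.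
    rewrite /Rintegral; under eq_integral do rewrite fK.
    by rewrite -fE//; exact: (congr1 fine (lebesgue_stieltjes_itv upper_part _ _ st)).
  rewrite /upper_part; ring.
Qed.

End LipschitzPrimitive.

(** * Lp convergence *)

Section LebesgueSpaces.
Context {R : realType}.
Local Notation mu := (@lebesgue_measure R).
Implicit Types (T p q : R) (f g h k : R -> R).

Let mI T : measurable (Icc T : set (measurableTypeR R)).
Proof. exact: measurable_itv. Qed.

Lemma integrable_Icc_cst T c : mu.-integrable (Icc T) (EFin \o (fun=> c)).
Proof.
apply/integrableP; split; first exact/measurable_EFinP.
rewrite integral_cst// lte_mul_pinfty//.
change (mu (`[0%R, T]%classic : set R) < +oo)%E.
by rewrite lebesgue_measure_itv /=; case: ifP => _; rewrite ?ltry.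
Qed.

Lemma powR_lt q (y e : R) : 0 < q -> 0 <= y -> 0 < e -> y < e `^ q^-1 -> y `^ q < e.
Proof.
move=> q0 y0 e0 ye.
have := gt0_ltr_powR q0 (_ : y \in Num.nneg) (_ : e `^ q^-1 \in Num.nneg) ye.
rewrite !nnegrE powR_ge0 => /(_ y0 isT).
by rewrite -powRrM mulVf ?gt_eqF// powRr1// ltW.
Qed.

Lemma measurable_norm_powR T q g : measurable_fun (Icc T) g ->
  measurable_fun (Icc T) (fun t => `|g t| `^ q).
Proof.
move=> mg; apply: (measurableT_comp (measurable_powR q)).
exact: (measurableT_comp (@normr_measurable _ setT) mg).
Qed.

Lemma measurable_EFin_norm_powR T q g : measurable_fun (Icc T) g ->
  measurable_fun (Icc T : set (measurableTypeR R)) (fun t => (`|g t| `^ q)%:E).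
Proof.
by move=> mg; apply/measurable_EFinP; refine (measurable_norm_powR _ _ _ mg).
Qed.

Lemma inLpP T p g : inLp T p g <->
  measurable_fun (Icc T) g /\ mu.-integrable (Icc T) (EFin \o (fun t => `|g t| `^ p)).
Proof.
have E : (\int[mu]_(t in Icc T) `|((EFin \o (fun t => `|g t| `^ p)%R) t)|)%E =
    (\int[mu]_(t in Icc T) ((`|g t| `^ p)%R%:E))%E.
  by apply: eq_integral => t _ /=; rewrite ger0_norm// powR_ge0.
split=> -[mg ig]; split=> //.
  apply/integrableP; split; last by rewrite E.
  exact: measurable_EFin_norm_powR.
by move/integrableP : ig => [_]; rewrite E.
Qed.

Lemma inLp_scale T p g c : 0 <= c -> inLp T p g -> inLp T p (fun t => c * `|g t|).
Proof.
move=> c0 /inLpP[mg ig]; apply/inLpP; split.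
  by apply: measurable_funM => //; exact: (measurableT_comp (@normr_measurable _ setT) mg).
rewrite (_ : EFin \o _ = fun t => ((c `^ p)%:E * (EFin \o (fun t => `|g t| `^ p)%R) t)%E).
  exact: integrableZl.
by apply/funext => t /=; rewrite normrM normr_id ger0_norm// powRM.
Qed.

Lemma inLp_dominated T p g k : 0 <= p -> measurable_fun (Icc T) g -> inLp T p k ->
  {ae mu, forall t, Icc T t -> `|g t| <= k t} -> inLp T p g.
Proof.
move=> p0 mg [mk ik] gk; split=> //; apply: le_lt_trans ik.
apply: ae_ge0_le_integral => //.
- exact: measurable_EFin_norm_powR.
- exact: measurable_EFin_norm_powR.
apply: ae_imp gk => t + It => /(_ It) gk.
by rewrite lee_fin ge0_ler_powR ?nnegrE// (le_trans gk)// ler_norm.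
Qed.

Lemma inLp_integrable T p g : 1 <= p -> inLp T p g ->
  mu.-integrable (Icc T) (EFin \o g).
Proof.
move=> p1 /inLpP[mg ig].
(* The interval has finite measure, and [|g| <= 1 + |g|^p]. *)
have i1 := integrableD (mI T) (integrable_Icc_cst T 1) ig.
apply: (le_integrable (mI T) _ _ i1); first exact/measurable_EFinP.
move=> t _; rewrite /= lee_fin [leRHS]ger0_norm ?addr_ge0 ?powR_ge0//.
have [g1|/ltW g1] := leP `|g t| 1; first by rewrite ler_wpDr ?powR_ge0.
by rewrite ler_wpDl// -[leLHS]powRr1// ler_powR.
Qed.

(** Dominated convergence for [|g - g_n|^q] with bound [(2 |k|)^q]; the exponent [q] will be [p] for
    derivatives and 1 for their primitives. *)
Lemma Lp_dominated_cvg T q (g_ : nat -> R -> R) g k : 0 < q ->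
  (forall n, measurable_fun (Icc T) (g_ n)) -> measurable_fun (Icc T) g ->
  (forall t, Icc T t -> g_ n t @[n --> \oo] --> g t) ->
  (forall n t, Icc T t -> `|g_ n t| <= k t) -> (forall t, Icc T t -> `|g t| <= k t) ->
  inLp T q k -> forall e, 0 < e -> exists N, forall n, (N <= n)%N ->
    fine (\int[mu]_(t in Icc T) ((`|g t - g_ n t| `^ q)%:E)) < e.
Proof.
move=> q0 mg_ mg gg gk gk' Lk e e0.
have /inLpP[_ i2k] := inLp_scale T q k 2 (ler0n _ 2) Lk.
have mf n : measurable_fun (Icc T) (fun t => (`|g t - g_ n t| `^ q)%:E).
  apply: (measurable_EFin_norm_powR T q (fun t => g t - g_ n t)).
  exact: measurable_funB.
have dk n t : Icc T t -> `|g t - g_ n t| `^ q <= `|2 * `|k t| | `^ q.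
  move=> It; rewrite ge0_ler_powR ?nnegrE ?(ltW q0)//.
  rewrite [leRHS]ger0_norm ?mulr_ge0// (le_trans (ler_normB _ _))//.
  have := gk n t It; have := gk' t It; have := ler_norm (k t); lra.
have fcvg t : Icc T t -> (`|g t - g_ n t| `^ q)%:E @[n --> \oo] --> 0%E.
  move=> It; apply: cvg_EFin; first exact: nearW.
  apply/cvgrPdist_lt => d d0; have d'0 : 0 < d `^ q^-1 by rewrite powR_gt0.
  have /cvgrPdist_lt/(_ _ d'0) := gg t It; apply: filterS => n H /=.
  by rewrite sub0r normrN ger0_norm ?powR_ge0//; exact: powR_lt.
have [||_ _] := dominated_convergence (mI T) mf (measurable_cst 0%E) _ i2k.
- by apply: aeW => t It; exact: fcvg.
- apply: aeW => t n It; rewrite /= lee_fin ger0_norm ?powR_ge0//; exact: dk.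
rewrite integral0 => /fine_cvgP[_ /cvgrPdist_lt/(_ _ e0)[N _ HN]].
exists N => n /HN /=; rewrite sub0r normrN; apply: le_lt_trans; exact: ler_norm.
Qed.

Lemma Lpnorm_dominated_cvg T p (g_ : nat -> R -> R) g k : 0 < p ->
  (forall n, measurable_fun (Icc T) (g_ n)) -> measurable_fun (Icc T) g ->
  (forall t, Icc T t -> g_ n t @[n --> \oo] --> g t) ->
  (forall n t, Icc T t -> `|g_ n t| <= k t) -> (forall t, Icc T t -> `|g t| <= k t) ->
  inLp T p k -> forall e, 0 < e -> exists N, forall n, (N <= n)%N ->
    Lpnorm T p (g \- g_ n) < e.
Proof.
move=> p0 mg_ mg gg gk gk' Lk e e0.
have [|N HN] := Lp_dominated_cvg _ _ _ _ _ p0 mg_ mg gg gk gk' Lk (e `^ p).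
  by rewrite powR_gt0.
exists N => n /HN ?; apply: powR_lt => //; rewrite ?invr_gt0// ?invrK//.
by apply: fine_ge0; apply: integral_ge0 => t _; rewrite lee_fin powR_ge0.
Qed.

Lemma L1dist_dominated_cvg T (g_ : nat -> R -> R) g k :
  (forall n, measurable_fun (Icc T) (g_ n)) -> measurable_fun (Icc T) g ->
  (forall t, Icc T t -> g_ n t @[n --> \oo] --> g t) ->
  (forall n t, Icc T t -> `|g_ n t| <= k t) -> (forall t, Icc T t -> `|g t| <= k t) ->
  mu.-integrable (Icc T) (EFin \o k) -> forall e, 0 < e -> exists N, forall n, (N <= n)%N ->
    L1dist T g (g_ n) < e.
Proof.
move=> mg_ mg gg gk gk' ik e e0.
have Lk : inLp T 1 k.
  apply/inLpP; split.
    by apply: (@measurable_funS _ _ (measurableTypeR R) _ (Icc T)) => //;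
      apply/measurable_EFinP; exact: (measurable_int mu ik).
  rewrite (_ : EFin \o _ = EFin \o (fun t => `|k t|)); first exact: integrable_norm.
  by apply/funext => t /=; rewrite powRr1.
have [N HN] := Lp_dominated_cvg _ _ _ _ _ ltr01 mg_ mg gg gk gk' Lk _ e0.
exists N => n /HN; congr (fine _ < _); apply: eq_integral => t _.
by rewrite powRr1.
Qed.

End LebesgueSpaces.

(** * Sobolev functions *)

Section SobolevFunctions.
Context {R : realType}.
Local Notation mu := (@lebesgue_measure R).
Implicit Types (T p c : R) (f g k x : R -> R).

Let mI T : measurable (Icc T : set (measurableTypeR R)).
Proof. exact: measurable_itv. Qed.

Lemma restrict_ge0 T k : (forall t, 0 <= k t) -> forall t, 0 <= (k \_ (Icc T)) t.
Proof. by move=> k0 t; rewrite patchE; case: ifP. Qed.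

Lemma ae_restrict_le T g k : {ae mu, forall t, Icc T t -> `|g t| <= k t} ->
  {ae mu, forall t, `|(g \_ (Icc T)) t| <= (k \_ (Icc T)) t}.
Proof.
apply: ae_imp => t H; rewrite !patchE; case: ifPn => [|_].
  by rewrite inE => /H.
by rewrite normr0.
Qed.

(** Since the bound does not involve [t], convergence in [L^1] becomes uniform convergence of
    primitives. *)
Lemma prim_L1dist T f g t :
  mu.-integrable (Icc T) (EFin \o f) -> mu.-integrable (Icc T) (EFin \o g) ->
  `|prim (f \_ (Icc T)) t - prim (g \_ (Icc T)) t| <= L1dist T f g.
Proof.
move=> /integrable_Icc_restrict fi /integrable_Icc_restrict gi.
have mt : measurable (`]-oo, t]%classic : set (measurableTypeR R)) by exact: measurable_itv.
have fti := integrableS measurableT mt (@subsetT _ _) fi.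
have gti := integrableS measurableT mt (@subsetT _ _) gi.
rewrite /prim -RintegralB//.
have di := integrableB measurableT fi gi.
apply: le_trans (prim_bound (fun s => (f \_ (Icc T)) s - (g \_ (Icc T)) s)
  (fun s => `|(f \_ (Icc T)) s - (g \_ (Icc T)) s|) t di (integrable_norm di) _ _) _.
- by move=> s.
- by apply: aeW => s.
rewrite -[L1dist _ _ _]/(\int[mu]_(s in Icc T) `|f s - g s|) [leRHS]Rintegral_mkcond.
rewrite le_eqVlt; apply/orP; left; apply/eqP; apply: eq_Rintegral => s _.
rewrite !patchE; case: ifP => // _.
by rewrite subrr normr0.
Qed.

Lemma W1p_deriv_prim T p c g : 1 <= p -> inLp T p g ->
  W1p_deriv T p (fun t => c + prim (g \_ (Icc T)) t) g.
Proof.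
by move=> p1 Lg; split=> // t t0T; rewrite prim_restrict0 addr0 prim_restrict.
Qed.

(** The density from [lip_prim] is dominated by [k], hence lies in [L^p]. This puts the whole
    compact set inside the domain where [A] is controlled. *)
Lemma lip_W1p T p k x : 1 <= p -> inLp T p k -> (forall t, 0 <= k t) ->
  (forall s t, `|x s - x t| <= `|prim (k \_ (Icc T)) s - prim (k \_ (Icc T)) t|) ->
  W1p T p x.
Proof.
move=> p1 Lk k0 xk; have /integrable_Icc_restrict ik := inLp_integrable _ _ _ p1 Lk.
have [g [ig gk xg]] := lip_prim _ _ ik (restrict_ge0 T k k0) xk.
exists g; split.
  apply: inLp_dominated Lk _ => //; first exact: le_trans p1.
    apply: (@measurable_funTS _ _ (measurableTypeR R)); apply/measurable_EFinP.
    exact: (measurable_int mu ig).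
  by apply: ae_imp gk => t + It; rewrite patchE mem_set.
move=> t /andP[t0 tT]; rewrite -[LHS](subrK (x 0)) addrC xg//; congr (_ + _).
rewrite Rintegral_itv_obnd_cbnd//.
apply: (integrableS measurableT _ (@subsetT _ _) ig); exact: measurable_itv.
Qed.

Lemma ae_prim_derivable T c f : mu.-integrable (Icc T) (EFin \o f) ->
  {ae mu, forall t, Icc T t -> let u s := c + prim (f \_ (Icc T)) s in
     derivable u t 1 /\ derive1 u t = f t}.
Proof.
move=> fi; have /integrable_Icc_restrict fi' := fi.
have iy y : mu.-integrable `]-oo, y] (EFin \o (f \_ (Icc T))).
  by apply: (integrableS measurableT _ (@subsetT _ _) fi'); exact: measurable_itv.
have H := FTC1Ny iy (integrable_locally_restrict (mI T) fi).
apply: ae_imp H => t [dF F'] It /=; rewrite -/(prim _) in dF F'.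
split; first by apply: derivableD => //; exact: derivable_cst.
rewrite derive1E deriveD//; first by rewrite derive_cst add0r -derive1E F' patchE mem_set.
Qed.

(** Absolute continuity of the integral of [|f|], applied to the union of the given intervals. *)
Lemma abs_cont_prim T c f : mu.-integrable setT (EFin \o f) ->
  abs_cont_on T (fun t => c + prim f t).
Proof.
move=> fi e e0; have [d [d0 Hd]] := integral_normr_continuous fi e0.
exists d => // n a b ab disj sab.
(* Half-open, so that intervals sharing an endpoint are disjoint. *)
pose D (k : nat) : set (measurableTypeR R) := `]a k, b k]%classic.
have mD (k : nat) : measurable (D k) by exact: measurable_itv.
pose U (m : nat) : set (measurableTypeR R) := \big[setU/set0]_(k < m) D k.
have mU (m : nat) : measurable (U m) by exact: bigsetU_measurable.
have Dab (k : nat) : (k < n)%N -> mu (D k) = (b k - a k)%:E.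
  move=> kn; have [/andP[_ akbk] _] := ab k kn.
  change (mu (`]a k, b k]%classic : set R) = (b k - a k)%:E).
  rewrite lebesgue_measure_itv /= lte_fin; case: ltP => // bak.
  by rewrite (_ : b k - a k = 0)//; lra.
have main (m : nat) : (m <= n)%N -> (mu (U m) <= (\sum_(k < m) (b k - a k))%:E)%E /\
    \sum_(k < m) `|(c + prim f (b k)) - (c + prim f (a k))| <= \int[mu]_(t in U m) `|f t|.
  elim: m => [_|m IH mn].
    by rewrite /U !big_ord0 measure0 Rintegral_set0.
  have [IH1 IH2] := IH (ltnW mn).
  rewrite /U !big_ord_recr /= -/(U m); split.
    rewrite EFinD -Dab//; apply: le_trans (leeD IH1 (le_refl _)).
    exact: measureU2.
  have nfi : mu.-integrable setT (EFin \o (fun t => `|f t|)) := integrable_norm fi.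
  rewrite Rintegral_setU//; last 2 first.
  - by apply: integrableS nfi => //; exact: measurableU.
  - apply/disj_setPS => t; rewrite /U -bigcup_mkord => -[[j /= jm]].
    rewrite /D /= !in_itv /= => /andP[ajt tbj] /andP[amt tbm].
    have jn := ltn_trans jm mn; have [|H|H] := disj j m jn mn.
    + by move=> jmE; move: jm; rewrite jmE ltnn.
    + by have := lt_le_trans amt tbj; rewrite ltNge H.
    + by have := lt_le_trans ajt tbm; rewrite ltNge H.
  apply: lerD => //; have [/andP[_ ambm] _] := ab m mn.
  rewrite opprD addrACA subrr add0r primB//; apply: le_normr_Rintegral => //.
  by apply: integrableS fi.
have [H1 H2] := main n (leqnn n); apply: le_lt_trans H2 _; apply: Hd => //.
by apply: le_lt_trans H1 _; rewrite lte_fin.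
Qed.

Lemma ae_Rintegral_ge0 T f : mu.-integrable (Icc T) (EFin \o f) ->
  {ae mu, forall t, Icc T t -> 0 <= f t} -> 0 <= \int[mu]_(t in Icc T) f t.
Proof.
move=> fi f0; rewrite /Rintegral (@ae_eq_integral _ _ _ mu (Icc T) (fun t => `|f t|%:E))//.
- by apply: fine_ge0; apply: integral_ge0 => t _; rewrite lee_fin.
- exact: (measurable_int mu fi).
- exact: (measurable_int mu (integrable_norm fi)).
- by apply: ae_imp f0 => t + It => /(_ It) ft0; rewrite ger0_norm.
Qed.

Definition clip (M a : R) := Num.max (- M) (Num.min a M).

Lemma clip_id M a : `|a| <= M -> clip M a = a.
Proof.
by rewrite ler_norml => /andP[Ma aM]; rewrite /clip min_l ?max_r.
Qed.

Lemma clip_bound M a : 0 <= M -> `|clip M a| <= M.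
Proof.
move=> M0; rewrite ler_norml /clip le_max lexx /= ge_max ge_min lexx orbT andbT.
by rewrite (le_trans _ M0)// oppr_le0.
Qed.

Lemma clip_gt M a : 0 <= M -> M < a -> clip M a = M.
Proof.
move=> M0 Ma; rewrite /clip min_r; last exact: ltW.
by rewrite max_r// (le_trans _ M0)// oppr_le0.
Qed.

Lemma clip_lt M a : 0 <= M -> a < - M -> clip M a = - M.
Proof.
move=> M0 aM; rewrite /clip max_l// ge_min; apply/orP; left; exact: ltW.
Qed.

Lemma clip_dist M a b : `|clip M a - clip M b| <= `|a - b|.
Proof.
have aux u v : u <= v -> clip M u <= clip M v /\ clip M v - clip M u <= v - u.
  rewrite /clip !maxEle !minEle => uv.
  by have [?|?] := leP u M; have [?|?] := leP v M; (have [?|?] := leP (- M) u);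
    (have [?|?] := leP (- M) v); (have [?|?] := leP (- M) M); split; lra.
have [ab|/ltW ab] := leP a b.
  rewrite distrC [leRHS]distrC; have [? ?] := aux _ _ ab.
  by rewrite !ger0_norm ?subr_ge0.
by have [? ?] := aux _ _ ab; rewrite !ger0_norm ?subr_ge0.
Qed.

End SobolevFunctions.

(** * The boundary value problem *)

Section BoundaryValueProblem.
Context {R : realType}.
Local Notation mu := (@lebesgue_measure R).
Variables (T nu1 nu2 p m : R) (Phi Phiinv : R -> R).
Variables (A F : (R -> R) -> (R -> R)) (h1 h2 psi : R -> R).
Hypotheses (T0 : 0 < T) (p1 : 1 < p).
Hypotheses (Phi_incr : {homo Phi : a b / a < b}) (PhiK : cancel Phi Phiinv).
Hypotheses (PhiinvK : cancel Phiinv Phi) (Phiinv_cont : continuous Phiinv).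
Hypothesis A_cont : forall x, W1p T p x -> {within (Icc T), continuous (A x)}.
Hypothesis A_sup : forall x, W1p T p x -> forall eps : R, 0 < eps ->
  exists2 delta : R, 0 < delta &
    forall y, W1p T p y -> sup_lt T x y delta -> sup_lt T (A x) (A y) eps.
Hypothesis h1_cont : {within (Icc T), continuous h1}.
Hypothesis h1_ge0 : forall t, 0 <= t <= T -> 0 <= h1 t.
Hypotheses (m0 : 0 < m) (h2m : forall t, 0 <= t <= T -> h2 t <= m).
Hypothesis h1_inv : inv_inLp T p h1.
Hypothesis hA : forall x, W1p T p x -> forall t, 0 <= t <= T -> h1 t <= A x t <= h2 t.
Hypothesis F_int : forall x, W1p T p x -> mu.-integrable (Icc T) (EFin \o F x).
Hypothesis F_cont : forall x, W1p T p x -> forall eps : R, 0 < eps ->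
  exists2 delta : R, 0 < delta &
    forall y gx gy, W1p_deriv T p x gx -> W1p_deriv T p y gy ->
      Lpnorm T p (x \- y) + Lpnorm T p (gx \- gy) < delta ->
      L1dist T (F x) (F y) < eps.
Hypothesis psi_int : mu.-integrable (Icc T) (EFin \o psi).
Hypothesis F_psi : forall x, W1p T p x ->
  {ae mu, forall t, (Icc T) t -> `|F x t| <= psi t}.

Let mI : measurable (Icc T : set (measurableTypeR R)).
Proof. exact: measurable_itv. Qed.

Let IccE t : Icc T t = (0 <= t <= T) :> Prop.
Proof. by rewrite /Icc /= in_itv. Qed.

Let p1W : 1 <= p. Proof. exact: ltW. Qed.
Let p_gt0 : 0 < p. Proof. exact: lt_trans p1. Qed.

(** The absolute value makes the bound nonnegative at every point, not just almost everywhere, so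
    that its primitive is monotone. *)
Definition flux_dom t := `|psi t|.
Definition flux_var := \int[mu]_t (flux_dom \_ (Icc T)) t.
(** As [A x <= m], keeping [A x * x'] above this value moves [x] by at least [|nu2 - nu1|] over a
    time [T]. *)
Definition min_slope := m * `|nu2 - nu1| / T.
(* If [Phi (A x')] equals this bound in absolute value at [t = 0], then
   [|x'| >= min_slope / m] with a constant sign, and [x] overshoots [nu2] at [T]. *)
Definition flux0_bound := flux_var + `|Phi min_slope| + `|Phi (- min_slope)|.
Definition flux_bound := flux0_bound + flux_var.
Definition Phiinv_bound := `|Phiinv flux_bound| + `|Phiinv (- flux_bound)|.
Definition slope_dom t := Phiinv_bound * `|(h1 t)^-1|.
Definition traj_var := \int[mu]_t (slope_dom \_ (Icc T)) t.
Definition radius := `|nu1| + traj_var + flux_bound + 1.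

(* The last factor is the indicator of [h1 <> 0] (as [0^-1 = 0]); it makes the bound by
   [slope_dom] hold everywhere. *)
Definition slope (x w : R -> R) t :=
  Phiinv (clip flux_bound (w t)) * ((A x t)^-1 * (h1 t * (h1 t)^-1)).
Definition traj x w t := nu1 + prim (slope x w \_ (Icc T)) t.
(** [F] is evaluated at the new trajectory instead of [x]: [F] is continuous for the norm of
    [W^{1,p}], and uniform convergence of [x] controls the derivative of [traj x w] but not that of
    [x]. *)
Definition flux x w t :=
  clip flux0_bound (w 0 + nu2 - traj x w T) + prim (F (traj x w) \_ (Icc T)) t.

(** The shift of the second copy separates the two ranges by at least [2 * radius], so the Lipschitz
    condition never relates a value of [x] to a value of [w]. *)
Definition kap (s : R + R) := match s with
  | inl t => prim (slope_dom \_ (Icc T)) t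
  | inr t => traj_var + 2 * radius + prim (flux_dom \_ (Icc T)) t
  end.

(* A point of [R + R -> R] encodes a pair (x, w) with [w = Phi (A_x x')]. *)
Definition solop (X : R + R -> R) (s : R + R) := match s with
  | inl t => traj (X \o inl) (X \o inr) t
  | inr t => flux (X \o inl) (X \o inr) t
  end.

Let flux_dom_ge0 t : 0 <= flux_dom t. Proof. exact: normr_ge0. Qed.
Let Phiinv_bound_ge0 : 0 <= Phiinv_bound. Proof. exact: addr_ge0. Qed.
Let slope_dom_ge0 t : 0 <= slope_dom t. Proof. by rewrite mulr_ge0. Qed.
Let slope_domr_ge0 t : 0 <= (slope_dom \_ (Icc T)) t. Proof. exact: restrict_ge0. Qed.
Let flux_domr_ge0 t : 0 <= (flux_dom \_ (Icc T)) t. Proof. exact: restrict_ge0. Qed.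
Let traj_var_ge0 : 0 <= traj_var. Proof. by apply: Rintegral_ge0 => t _. Qed.
Let flux_var_ge0 : 0 <= flux_var. Proof. by apply: Rintegral_ge0 => t _. Qed.
Let flux0_bound_ge0 : 0 <= flux0_bound. Proof. by rewrite !addr_ge0. Qed.
Let flux_bound_ge0 : 0 <= flux_bound. Proof. exact: addr_ge0. Qed.
Let radius_gt0 : 0 < radius. Proof. by rewrite ltr_wpDl// !addr_ge0. Qed.

Let slope_dom_Lp : inLp T p slope_dom.
Proof. by case: h1_inv => _; exact: inLp_scale. Qed.

Let slope_dom_int : mu.-integrable (Icc T) (EFin \o slope_dom).
Proof. exact: inLp_integrable p1W slope_dom_Lp. Qed.

Let flux_dom_int : mu.-integrable (Icc T) (EFin \o flux_dom).
Proof. exact: integrable_norm psi_int. Qed.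

Let slope_domr_int : mu.-integrable setT (EFin \o (slope_dom \_ (Icc T))).
Proof. exact/integrable_Icc_restrict. Qed.

Let flux_domr_int : mu.-integrable setT (EFin \o (flux_dom \_ (Icc T))).
Proof. exact/integrable_Icc_restrict. Qed.

Let Phiinv_nd : {homo Phiinv : a b / a <= b}.
Proof.
move=> a b ab; rewrite leNgt; apply/negP => /Phi_incr.
by rewrite !PhiinvK ltNge ab.
Qed.

Let Phiinv_clip a : `|Phiinv (clip flux_bound a)| <= Phiinv_bound.
Proof.
have := clip_bound flux_bound a flux_bound_ge0.
rewrite ler_norml => /andP[/Phiinv_nd l /Phiinv_nd u].
have := ler_norm (Phiinv flux_bound); have := ler_norm (- Phiinv (- flux_bound)).
have := normr_ge0 (Phiinv flux_bound); have := normr_ge0 (Phiinv (- flux_bound)).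
rewrite normrN /Phiinv_bound => ? ? ? ?; rewrite ler_norml; apply/andP; split; lra.
Qed.

Let prim_slope_dom t : 0 <= prim (slope_dom \_ (Icc T)) t <= traj_var.
Proof.
apply/andP; split; first exact: Rintegral_ge0.
apply: le_trans (ler_norm _) _; apply: prim_bound => //.
by apply: aeW => s; rewrite ger0_norm.
Qed.

Let prim_flux_dom t : 0 <= prim (flux_dom \_ (Icc T)) t <= flux_var.
Proof.
apply/andP; split; first exact: Rintegral_ge0.
apply: le_trans (ler_norm _) _; apply: prim_bound => //.
by apply: aeW => s; rewrite ger0_norm.
Qed.

Let kap_bound s : `|kap s| <= traj_var + 2 * radius + flux_var.
Proof.
have := traj_var_ge0; have := flux_var_ge0; have := radius_gt0 => ? ? ?.
case: s => t /=; [have := prim_slope_dom t|have := prim_flux_dom t] => /andP[? ?];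
  rewrite ler_norml; apply/andP; split; lra.
Qed.

Let slope_bound x w t : W1p T p x -> 0 <= t <= T -> `|slope x w t| <= slope_dom t.
Proof.
move=> Wx t0T; rewrite /slope /slope_dom normrM.
have [->|h0] := eqVneq (h1 t) 0.
  by rewrite mul0r mulr0 normr0 mulr0 mulr_ge0.
have hgt0 : 0 < h1 t by rewrite lt_def h0 h1_ge0.
have /andP[hle _] := hA x Wx t t0T.
rewrite divff// mulr1; apply: ler_pM => //.
by rewrite !gtr0_norm ?invr_gt0 ?(lt_le_trans hgt0)// lef_pV2 ?posrE// (lt_le_trans hgt0).
Qed.

Let slope_meas x w : W1p T p x -> continuous w -> measurable_fun (Icc T) (slope x w).
Proof.
move=> Wx cw; apply: measurable_funM.
  apply: (measurableT_comp (continuous_measurable_fun Phiinv_cont)).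
  apply: (@measurable_funTS _ _ R R _ (fun t => clip flux_bound (w t))).
  apply: continuous_measurable_fun => t; apply/cvgrPdist_lt => e e0.
  have /cvgrPdist_lt/(_ _ e0) := cw t; apply: filterS => s; apply: le_lt_trans.
  exact: clip_dist.
apply: measurable_funM.
  (* The inverse is handled as the power with exponent -1, with which it agrees on nonnegative
     numbers. *)
  apply: (@eq_measurable_fun _ _ R R (Icc T) (fun t => A x t `^ (-1))).
    move=> t; rewrite inE IccE => t0T; rewrite powR_inv1//.
    have /andP[+ _] := hA x Wx t t0T; exact: le_trans (h1_ge0 t t0T).
  apply: (measurableT_comp (measurable_powR (-1))).
  exact: subspace_continuous_measurable_fun (A_cont x Wx).
apply: measurable_funM; first exact: subspace_continuous_measurable_fun h1_cont.
by case: h1_inv => _ [].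
Qed.

Let slope_Lp x w : W1p T p x -> continuous w -> inLp T p (slope x w).
Proof.
move=> Wx cw; apply: inLp_dominated slope_dom_Lp _; first exact: ltW.
  exact: slope_meas.
by apply: aeW => t; rewrite IccE; exact: slope_bound.
Qed.

Let slope_int x w : W1p T p x -> continuous w ->
  mu.-integrable (Icc T) (EFin \o slope x w).
Proof. by move=> Wx cw; exact: inLp_integrable p1W (slope_Lp x w Wx cw). Qed.

Let traj_W1p_deriv x w : W1p T p x -> continuous w ->
  W1p_deriv T p (traj x w) (slope x w).
Proof. by move=> Wx cw; exact (W1p_deriv_prim _ _ _ _ p1W (slope_Lp x w Wx cw)). Qed.

Let traj_W1p x w : W1p T p x -> continuous w -> W1p T p (traj x w).
Proof. by move=> Wx cw; exists (slope x w); exact: traj_W1p_deriv. Qed.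

Let F_flux_dom x : W1p T p x -> {ae mu, forall t, (Icc T) t -> `|F x t| <= flux_dom t}.
Proof.
move=> /F_psi; apply: ae_imp => t + It => /(_ It) /le_trans; apply; exact: ler_norm.
Qed.

Let slope_slope_dom x w : W1p T p x ->
  {ae mu, forall t, (Icc T) t -> `|slope x w t| <= slope_dom t}.
Proof. by move=> Wx; apply: aeW => t; rewrite IccE; exact: slope_bound. Qed.

Let ball_W1p X : lip_ball kap radius X -> W1p T p (X \o inl).
Proof. by move=> [_ DX]; apply: lip_W1p slope_dom_Lp _ _ => // s t; exact: DX. Qed.

Let ball_cont X : lip_ball kap radius X -> continuous (X \o inr).
Proof.
move=> [_ DX]; apply: (prim_lip_continuous _ _ flux_domr_int) => // s t.
by have := DX (inr s) (inr t); rewrite /= opprD addrACA subrr add0r.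
Qed.

Let solop_ball X : lip_ball kap radius X -> lip_ball kap radius (solop X).
Proof.
move=> DX; have Wx := ball_W1p X DX; have cw := ball_cont X DX.
set x := X \o inl in Wx; set w := X \o inr in cw.
have Wy := traj_W1p x w Wx cw.
have /integrable_Icc_restrict si := slope_int x w Wx cw.
have /integrable_Icc_restrict Fi := F_int _ Wy.
have sk := ae_restrict_le _ _ _ (slope_slope_dom x w Wx).
have Fk := ae_restrict_le _ _ _ (F_flux_dom _ Wy).
have bound s : `|solop X s| <= radius.
  case: s => t /=.
    apply: le_trans (ler_normD _ _) _.
    have := prim_bound _ _ t si slope_domr_int slope_domr_ge0 sk; rewrite -/traj_var.
    by have := flux_bound_ge0; rewrite /radius; lra.
  apply: le_trans (ler_normD _ _) _.
  have := prim_bound _ _ t Fi flux_domr_int flux_domr_ge0 Fk; rewrite -/flux_var.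
  have := clip_bound flux0_bound (w 0 + nu2 - traj x w T) flux0_bound_ge0.
  by have := traj_var_ge0; have := normr_ge0 nu1; rewrite /radius /flux_bound; lra.
have cross s t : `|solop X (inl s) - solop X (inr t)| <= `|kap (inl s) - kap (inr t)|.
  apply: le_trans (ler_normB _ _) _; rewrite [leRHS]distrC.
  apply: le_trans (ler_norm _); have := bound (inl s); have := bound (inr t).
  by have /andP[_] := prim_slope_dom s; have /andP[+ _] := prim_flux_dom t; rewrite /kap; lra.
split=> // -[s|s] [t|t]; [|exact: cross|by rewrite distrC [leRHS]distrC|].
  by rewrite /= opprD addrACA subrr add0r; exact: prim_dist.
have E (a b c : R) : a + b - (a + c) = b - c by ring.
by rewrite /= /flux !E; exact: prim_dist.
Qed.

Let ball_cont_inl X : lip_ball kap radius X -> continuous (X \o inl).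
Proof.
by move=> [_ DX]; apply: (prim_lip_continuous _ _ slope_domr_int) => // s t; exact: DX.
Qed.

Let cst_Lp c : inLp T p (fun=> c).
Proof.
apply/inLpP; split; first exact: measurable_cst.
exact: integrable_Icc_cst.
Qed.

(** Uniform convergence of the pairs gives pointwise convergence of the slopes, dominated by
    [slope_dom]. Hence slopes converge in [L^p], trajectories in [W^{1,p}], their images under [F]
    in [L^1], and the primitives of these uniformly. *)
Let solop_cvg (X_ : nat -> R + R -> R) X : (forall n, lip_ball kap radius (X_ n)) ->
  lip_ball kap radius X -> unif_cvg X_ X -> unif_cvg (solop \o X_) (solop X).
Proof.
move=> DX_ DX XX.
pose x := X \o inl; pose w := X \o inr.
pose x_ n := X_ n \o inl; pose w_ n := X_ n \o inr.
have Wx : W1p T p x := ball_W1p X DX.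
have cw : continuous w := ball_cont X DX.
have Wx_ n : W1p T p (x_ n) := ball_W1p _ (DX_ n).
have cw_ n : continuous (w_ n) := ball_cont _ (DX_ n).
have Acvg t : Icc T t -> A (x_ n) t @[n --> \oo] --> A x t.
  rewrite IccE => t0T; apply/cvgrPdist_lt => e e0; have [d d0 Hd] := A_sup x Wx e e0.
  have [N HN] := XX (d / 2) ltac:(lra); exists N => // n /= Nn.
  have xx : sup_lt T x (x_ n) d.
    by exists (d / 2) => [|s _]; [lra|rewrite distrC; exact: HN].
  have [e' e'e He'] := Hd _ (Wx_ n) xx.
  exact: le_lt_trans (He' t t0T) e'e.
have wcvg t : clip flux_bound (w_ n t) @[n --> \oo] --> clip flux_bound (w t).
  apply/cvgrPdist_lt => e e0; have [N HN] := XX (e / 2) ltac:(lra).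
  exists N => // n /= Nn; apply: le_lt_trans (clip_dist _ _ _) _; rewrite distrC.
  by have := HN n Nn (inr t); rewrite /w_ /w /=; lra.
pose s := slope x w; pose s_ n := slope (x_ n) (w_ n).
have scvg t : Icc T t -> s_ n t @[n --> \oo] --> s t.
  move=> It; rewrite /s /s_ /slope; have [h0|h0] := eqVneq (h1 t) 0.
    rewrite h0 mul0r !mulr0; under eq_fun do rewrite !mulr0; exact: cvg_cst.
  apply: cvgM; first by apply: continuous_cvg; [exact: Phiinv_cont|exact: wcvg].
  apply: cvgM; last exact: cvg_cst.
  apply: cvgV; last exact: Acvg.
  move: It; rewrite IccE => t0T; have /andP[hle _] := hA x Wx t t0T.
  by rewrite gt_eqF// (lt_le_trans _ hle)// lt_def h0 h1_ge0.
have ms_ n : measurable_fun (Icc T) (s_ n) := slope_meas _ _ (Wx_ n) (cw_ n).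
have ms : measurable_fun (Icc T) s := slope_meas _ _ Wx cw.
have sk_ n t : Icc T t -> `|s_ n t| <= slope_dom t by rewrite IccE; exact: slope_bound.
have sk t : Icc T t -> `|s t| <= slope_dom t by rewrite IccE; exact: slope_bound.
pose y := traj x w; pose y_ n := traj (x_ n) (w_ n).
have Wy : W1p_deriv T p y s := traj_W1p_deriv _ _ Wx cw.
have Wy_ n : W1p_deriv T p (y_ n) (s_ n) := traj_W1p_deriv _ _ (Wx_ n) (cw_ n).
have ycvg : unif_cvg y_ y.
  move=> e e0; have [N HN] := L1dist_dominated_cvg _ _ _ _ ms_ ms scvg sk_ sk slope_dom_int _ e0.
  exists N => n /HN /ltW H t; apply: le_trans H.
  rewrite distrC /y /y_ /traj opprD addrACA subrr add0r.
  by apply: prim_L1dist; exact: slope_int.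
have yp t : Icc T t -> y_ n t @[n --> \oo] --> y t.
  move=> _; apply/cvgrPdist_lt => e e0; have [N HN] := ycvg (e / 2) ltac:(lra).
  by exists N => // n /= Nn; rewrite distrC; have := HN n Nn t; lra.
have my X' : lip_ball kap radius X' -> measurable_fun (Icc T) (traj (X' \o inl) (X' \o inr)).
  move=> DX'; apply: (@measurable_funTS _ _ R R); apply: continuous_measurable_fun.
  exact: (ball_cont_inl _ (solop_ball _ DX')).
have yB X' t : lip_ball kap radius X' -> `|traj (X' \o inl) (X' \o inr) t| <= radius.
  by move=> DX'; exact: ((solop_ball _ DX').1 (inl t)).
have Ecvg e : 0 < e -> exists N, forall n, (N <= n)%N -> L1dist T (F y) (F (y_ n)) < e.
  move=> e0; have [d d0 Hd] := F_cont _ (ex_intro _ s Wy) e e0.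
  have [N1 H1] := Lpnorm_dominated_cvg _ _ _ _ _ p_gt0 ms_ ms scvg sk_ sk
    slope_dom_Lp (d / 2) ltac:(lra).
  have [N2 H2] := Lpnorm_dominated_cvg _ _ y_ y (fun=> radius) p_gt0 (fun n => my _ (DX_ n))
    (my _ DX) yp (fun n t _ => yB _ t (DX_ n)) (fun t _ => yB _ t DX) (cst_Lp radius)
    (d / 2) ltac:(lra).
  exists (maxn N1 N2) => n; rewrite geq_max => /andP[/H1 n1 /H2 n2].
  by apply: (Hd _ _ _ Wy (Wy_ n)); rewrite [d]splitr; exact (ltrD n2 n1).
move=> e e0; have e4 : 0 < e / 4 by lra.
have [N1 H1] := XX _ e4; have [N2 H2] := ycvg _ e4; have [N3 H3] := Ecvg _ e4.
exists (maxn N1 (maxn N2 N3)) => n; rewrite !geq_max => /and3P[/H1 n1 /H2 n2 /H3 n3].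
case=> t; first by have := n2 t; rewrite /y /y_ /=; lra.
rewrite /= /flux -/x -/w -/(x_ n) -/(w_ n) -/y -/(y_ n).
have D (a b c d : R) : a + b - (c + d) = (a - c) + (b - d) by ring.
rewrite D; apply: le_trans (ler_normD _ _) _.
have f1 : `|w_ n 0 - w 0| <= e / 4 := n1 (inr 0).
have f2 : `|y_ n T - y T| <= e / 4 := n2 T.
have f3 := prim_L1dist T (F y) (F (y_ n)) t (F_int _ (ex_intro _ _ Wy))
  (F_int _ (ex_intro _ _ (Wy_ n))).
rewrite distrC in f3; have f4 := clip_dist flux0_bound (w_ n 0 + nu2 - y_ n T) (w 0 + nu2 - y T).
have E : w_ n 0 + nu2 - y_ n T - (w 0 + nu2 - y T) = (w_ n 0 - w 0) - (y_ n T - y T) by ring.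
rewrite E in f4; have f5 := ler_normB (w_ n 0 - w 0) (y_ n T - y T).
have f45 := le_trans f4 f5; have f12 := lerD f1 f2; have f3' := le_trans f3 (ltW n3).
by apply: le_trans (lerD (le_trans f45 f12) f3') _; lra.
Qed.

Let h1_neq0 : {ae mu, forall t, Icc T t -> h1 t != 0}.
Proof.
exists (Icc T `&` [set t | h1 t = 0]); split.
- have mh1 : measurable_fun (Icc T) h1.
    exact: subspace_continuous_measurable_fun h1_cont.
  exact: (mh1 mI [set 0] (measurable_set1 _)).
- by case: h1_inv.
- by move=> t /= /not_implyP[It /negP]; rewrite negbK => /eqP.
Qed.

Let Rintegral_Icc_cst c : \int[mu]_(t in Icc T) c = c * T.
Proof.
rewrite Rintegral_cst//; congr (_ * _).
change (fine (mu (`[0%R, T]%classic : set R)) = T).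
by rewrite lebesgue_measure_itv /= lte_fin T0 /= subr0.
Qed.

Let slope_integral_ge x w c : W1p T p x -> continuous w ->
  {ae mu, forall t, Icc T t -> c <= slope x w t} ->
  c * T <= \int[mu]_(t in Icc T) slope x w t.
Proof.
move=> Wx cw cs; have ci := integrable_Icc_cst T c; have si := slope_int _ _ Wx cw.
rewrite -subr_ge0 -Rintegral_Icc_cst -RintegralB//; apply: ae_Rintegral_ge0.
  exact (integrableB mI si ci).
by apply: ae_imp cs => t + It => /(_ It); rewrite subr_ge0.
Qed.

Let slope_integral_le x w c : W1p T p x -> continuous w ->
  {ae mu, forall t, Icc T t -> slope x w t <= c} ->
  \int[mu]_(t in Icc T) slope x w t <= c * T.
Proof.
move=> Wx cw cs; have ci := integrable_Icc_cst T c; have si := slope_int _ _ Wx cw.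
rewrite -subr_ge0 -Rintegral_Icc_cst -RintegralB//; apply: ae_Rintegral_ge0.
  exact (integrableB mI ci si).
by apply: ae_imp cs => t + It => /(_ It); rewrite subr_ge0.
Qed.

Lemma bvp_solution : exists x : R -> R,
  W1p T p x /\ x 0 = nu1 /\ x T = nu2 /\
  exists g u : R -> R,
    W1p_deriv T p x g /\ abs_cont_on T u /\
    {ae mu, forall t, (Icc T) t -> u t = Phi (A x t * g t)} /\
    {ae mu, forall t, (Icc T) t -> derivable u t 1 /\ derive1 u t = F x t}.
Proof.
have [X DX fX] := schauder_lip_ball kap _ radius (inl 0) kap_bound radius_gt0
  solop solop_ball solop_cvg.
pose x := X \o inl; pose w := X \o inr.
have Wx : W1p T p x := ball_W1p X DX.
have cw : continuous w := ball_cont X DX.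
have xE : traj x w = x by apply/funext => t; exact: (fX (inl t)).
have Fi := F_int _ Wx; have /integrable_Icc_restrict Fri := Fi.
have w0E : w 0 = clip flux0_bound (w 0 + nu2 - x T).
  rewrite -[LHS]/(X (inr 0)) -[LHS]fX /= /flux -/x -/w xE.
  by rewrite prim_restrict0 addr0.
have wE : w = fun t => w 0 + prim (F x \_ (Icc T)) t.
  apply/funext => t; rewrite -[LHS]/(X (inr t)) -[LHS]fX /= /flux -/x -/w xE.
  by rewrite -w0E.
have w0M : `|w 0| <= flux0_bound by rewrite w0E clip_bound.
have wd t : `|w t - w 0| <= flux_var.
  rewrite [in X in `|X - _|]wE addrC addKr.
  exact: prim_bound Fri flux_domr_int flux_domr_ge0 (ae_restrict_le _ _ _ (F_flux_dom _ Wx)).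
(* The truncation inside [slope] is inactive: [w] starts within [flux0_bound] and varies by at most
   [flux_var]. *)
have wW t : clip flux_bound (w t) = w t.
  apply: clip_id; rewrite -[w t](subrK (w 0)) (le_trans (ler_normD _ _))//.
  by rewrite addrC /flux_bound lerD.
have TT : 0 <= T <= T by rewrite lexx ltW.
have xT : x T = nu1 + \int[mu]_(t in Icc T) slope x w t.
  by rewrite -[in LHS]xE /traj prim_restrict.
have L0E : min_slope / m * T = `|nu2 - nu1|.
  by rewrite /min_slope; field; rewrite !gt_eqF.
have min_slope_ge0 : 0 <= min_slope by rewrite /min_slope divr_ge0 ?mulr_ge0// ltW.
have slopeE t : h1 t != 0 -> slope x w t = Phiinv (w t) * (A x t)^-1.
  by move=> h0; rewrite /slope wW divff// mulr1.
have Apos t : 0 <= t <= T -> h1 t != 0 -> 0 < A x t <= m.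
  move=> t0T h0; have /andP[l u] := hA x Wx t t0T.
  by rewrite (le_trans u (h2m t t0T)) (lt_le_trans _ l)// lt_def h0 h1_ge0.
have dP (a : R) : a <= `|a| := ler_norm a.
have xT2 : x T = nu2.
  (* Were the truncation active from above, then [w 0 = flux0_bound] and the case hypothesis says
     [x T < nu2]. But [w] would stay above [Phi min_slope], forcing [x T >= nu1 + |nu2 - nu1|]. The
     case below is symmetric. *)
  have [a1|a1] := ltP flux0_bound (w 0 + nu2 - x T).
    have w0 : w 0 = flux0_bound by rewrite w0E clip_gt.
    suff : nu1 + `|nu2 - nu1| <= x T by have := dP (nu2 - nu1); move: a1; rewrite w0; lra.
    rewrite xT lerD2l -L0E; apply: slope_integral_ge => //.
    apply: ae_imp h1_neq0 => t + It => /(_ It) h0; move: It; rewrite IccE => t0T.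
    rewrite slopeE//; have /andP[Ap Am] := Apos t t0T h0.
    apply: ler_pM => //; rewrite ?invr_ge0 ?(ltW m0)//; last by rewrite lef_pV2 ?posrE.
    rewrite -[min_slope]PhiK; apply: Phiinv_nd.
    have := wd t; have := dP (Phi min_slope); have := normr_ge0 (Phi (- min_slope)).
    by rewrite ler_distl w0 /flux0_bound => ? ? /andP[? ?]; lra.
  have [a2|a2] := ltP (w 0 + nu2 - x T) (- flux0_bound).
    have w0 : w 0 = - flux0_bound by rewrite w0E clip_lt.
    suff : x T <= nu1 - `|nu2 - nu1|.
      by have := dP (- (nu2 - nu1)); rewrite normrN; move: a2; rewrite w0; lra.
    rewrite xT lerD2l -L0E -mulNr; apply: slope_integral_le => //.
    apply: ae_imp h1_neq0 => t + It => /(_ It) h0; move: It; rewrite IccE => t0T.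
    rewrite slopeE//; have /andP[Ap Am] := Apos t t0T h0.
    rewrite -lerN2 opprK -mulNr.
    apply: ler_pM => //; rewrite ?invr_ge0 ?(ltW m0)//; last by rewrite lef_pV2 ?posrE.
    rewrite lerNr -[- min_slope]PhiK; apply: Phiinv_nd.
    have := wd t; have := dP (- Phi (- min_slope)); have := normr_ge0 (Phi min_slope).
    by rewrite normrN ler_distl w0 /flux0_bound => ? ? /andP[? ?]; lra.
  (* Without truncation the equation for [w 0] reads [w 0 = w 0 + nu2 - x T]. *)
  have : `|w 0 + nu2 - x T| <= flux0_bound by rewrite ler_norml a1 a2.
  by move=> /clip_id; rewrite -w0E; lra.
exists x; split=> //; split; first by rewrite -xE /traj prim_restrict0 addr0.
split=> //; exists (slope x w), w; split.
  by rewrite -{1}xE; exact: traj_W1p_deriv.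
split; first by rewrite wE; exact: abs_cont_prim.
split.
  (* Off the null set where [h1] vanishes, [A x] is positive and the quotient defining the slope can
     be undone. *)
  apply: ae_imp h1_neq0 => t + It => /(_ It) h0; move: It; rewrite IccE => t0T.
  have /andP[Ap _] := Apos t t0T h0.
  by rewrite slopeE// mulrCA divff ?mulr1 ?PhiinvK// gt_eqF.
by have := ae_prim_derivable T (w 0) _ Fi; rewrite /= -wE.
Qed.

End BoundaryValueProblem.

Theorem theorem2p5 (R : realType) (T nu1 nu2 p : R)
  (Phi : R -> R) (A F : (R -> R) -> (R -> R)) (h1 h2 psi : R -> R) :
  0 < T -> 1 < p ->
  (* (H1) *)
  {homo Phi : a b / a < b} -> continuous Phi ->
  (exists Phiinv : R -> R,
     cancel Phi Phiinv /\ cancel Phiinv Phi /\ continuous Phiinv) ->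
  (* (H2) *)
  (forall x, W1p T p x -> {within (Icc T), continuous (A x)}) ->
  (forall x, W1p T p x -> forall eps : R, 0 < eps -> exists2 delta : R, 0 < delta &
     forall y, W1p T p y -> sup_lt T x y delta -> sup_lt T (A x) (A y) eps) ->
  {within (Icc T), continuous h1} -> {within (Icc T), continuous h2} ->
  (forall t, 0 <= t <= T -> 0 <= h1 t /\ 0 <= h2 t) ->
  inv_inLp T p h1 -> inv_inLp T p h2 ->
  (forall x, W1p T p x -> forall t, 0 <= t <= T -> h1 t <= A x t <= h2 t) ->
  (* (H3) *)
  (forall x, W1p T p x -> (@lebesgue_measure R).-integrable (Icc T) (EFin \o F x)) ->
  (forall x, W1p T p x -> forall eps : R, 0 < eps -> exists2 delta : R, 0 < delta &
     forall y gx gy, W1p_deriv T p x gx -> W1p_deriv T p y gy ->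
       Lpnorm T p (x \- y) + Lpnorm T p (gx \- gy) < delta ->
       L1dist T (F x) (F y) < eps) ->
  (@lebesgue_measure R).-integrable (Icc T) (EFin \o psi) ->
  {ae @lebesgue_measure R, forall t, (Icc T) t -> 0 <= psi t} ->
  (forall x, W1p T p x ->
     {ae @lebesgue_measure R, forall t, (Icc T) t -> `|F x t| <= psi t}) ->
  (* conclusion: a solution exists *)
  exists x : R -> R,
    W1p T p x /\ x 0 = nu1 /\ x T = nu2 /\
    exists g u : R -> R,
      W1p_deriv T p x g /\
      abs_cont_on T u /\
      {ae @lebesgue_measure R, forall t, (Icc T) t -> u t = Phi (A x t * g t)} /\
      {ae @lebesgue_measure R, forall t, (Icc T) t ->
         derivable u t 1 /\ derive1 u t = F x t}.
Proof.
move=> T0 p1 Phi_incr _ [Phiinv [PhiK [PhiinvK Phiinv_cont]]] A_cont A_sup h1_cont h2_cont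
  h12_ge0 h1_inv _ hA F_int F_cont psi_int _ F_psi.
(* The bound [m] is the maximum of [h2] plus 1, the summand making it positive. *)
have [c cI h2c] := EVT_max (ltW T0) h2_cont.
have c0T : 0 <= c <= T by move: cI; rewrite in_itv.
apply: (bvp_solution T nu1 nu2 p (h2 c + 1) Phi Phiinv A F h1 h2 psi) => //.
- by move=> t /h12_ge0[].
- by rewrite ltr_wpDl// (h12_ge0 c c0T).2.
- by move=> t t0T; rewrite ler_wpDr// h2c// in_itv.
Qed.
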